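(* For each integer $k\ge 2$ let $$f_k(z)=\frac{d}{dz}\log\Big(\sum_{j=0}^{k-1}z^j\Big)=\frac{1+2z+\cdots+(k-1)z^{k-2}}{1+z+\cdots+z^{k-1}},\qquad z\in\mathbb{D}.$$ Then the linear span $\mathrm{Span}\{f_k : k=2,3,\ldots\}$ is dense in $\mathcal{H}=A_1^2(\mathbb{D})$.
   Context: $\mathbb{D}=\{z\in\mathbb{C}:|z|<1\}$ is the open unit disk. $dA=\pi^{-1}\,dx\,dy$ is the normalized area measure on $\mathbb{D}$, and $dA_1(z)=2(1-|z|^2)\,dA(z)$, a probability measure on $\mathbb{D}$. The weighted Bergman space $\mathcal{H}=A_1^2(\mathbb{D})$ is the Hilbert space of all analytic functions on $\mathbb{D}$ lying in $L^2(\mathbb{D},dA_1)$, with norm $\|f\|_2=\left(\int_{\mathbb{D}}|f|^2\,dA_1\right)^{1/2}$; for $f(z)=\sum_{n\ge 0}a_nz^n$ one has $\|f\|_2^2=\sum_{n\ge 0}\frac{2|a_n|^2}{(n+1)(n+2)}$. Density is with respect to $\|\cdot\|_2$. *)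

(* Defs.v *)
From HB Require Import structures.
From mathcomp Require Import all_boot all_order all_algebra.
From mathcomp Require Import complex.
From mathcomp Require Import all_classical all_reals all_analysis.

Set Implicit Arguments.
Unset Strict Implicit.
Unset Printing Implicit Defensive.

Import Order.TTheory GRing.Theory Num.Theory.
Import numFieldNormedType.Exports.

Local Open Scope classical_set_scope.
Local Open Scope ring_scope.

(* The complex numbers over R.  The cast to an abstract structure type gives
   access to the topology that MathComp-Analysis puts on every numFieldType;
   R[i] itself carries no such instance. *)
Definition cplx (R : realType) : numClosedFieldType := R[i]%C.

Definition unit_disk (R : realType) : set (cplx R) := [set z | `|z| < 1].

(* Functions on the disk are represented by total functions on the complex
   plane; analyticity on the disk and the norm depend only on their values
   on the disk. *)

Definition analytic_at (R : realType) (f : cplx R -> cplx R) (z : cplx R) :=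
  exists a : nat -> cplx R,
    \forall w \near z, series (fun n => a n * (w - z) ^+ n) @ \oo --> f w.

Definition analytic_on_disk (R : realType) (f : cplx R -> cplx R) :=
  forall z, unit_disk z -> analytic_at f z.

(* The point x + iy.  The norm on cplx R takes values in cplx R, hence the
   real parts below. *)
Definition cplx_of (R : realType) (p : R * R) : cplx R := Complex p.1 p.2.

(* Integral of g over the disk against
   dA_1 = 2 (1 - |z|^2) dA,  dA = pi^-1 dx dy. *)
Definition integral_dA1 (R : realType) (g : cplx R -> R) : \bar R :=
  (\int[lebesgue_measure \x lebesgue_measure]_(p in
       [set p : R * R | unit_disk (cplx_of p)])
     (g (cplx_of p) *
      (2 * (1 - complex.Re `|cplx_of p| ^+ 2) * pi^-1))%:E)%E.

Definition norm2 (R : realType) (f : cplx R -> cplx R) : \bar R :=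
  (integral_dA1 (fun z => (complex.Re `|f z| ^+ 2)%R) `^ 2^-1)%E.

Definition bergman (R : realType) : set (cplx R -> cplx R) :=
  [set f | analytic_on_disk f /\ (norm2 f < +oo)%E].

Definition dense_in_bergman (R : realType) (S : set (cplx R -> cplx R)) :=
  S `<=` @bergman R /\
  forall f, bergman f -> forall e : R, 0 < e ->
    exists2 g, S g & (norm2 (f \- g)%R < e%:E)%E.

(* Finite complex linear combinations of F 2, F 3, ... *)
Definition span_from2 (R : realType) (F : nat -> cplx R -> cplx R) :
    set (cplx R -> cplx R) :=
  [set g | exists (N : nat) (c : nat -> cplx R),
     g = fun z => \sum_(2 <= k < N) c k * F k z].

Definition fk (R : realType) (k : nat) (z : cplx R) : cplx R :=
  (\sum_(1 <= j < k) j%:R * z ^+ j.-1) / (\sum_(0 <= j < k) z ^+ j).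

(* fk k is the logarithmic derivative of 1 + z + ... + z^(k-1). *)
Lemma fk_logderiv (R : realType) (k : nat) (z : cplx R) :
  let P : {poly cplx R} := \sum_(0 <= j < k) 'X^j in
  fk k z = P^`().[z] / P.[z].
Proof.
rewrite /fk; congr (_ / _); last first.
  by rewrite horner_sum; apply: eq_bigr => j _; rewrite hornerXn.
rewrite raddf_sum horner_sum /=; case: k => [|k].
  by rewrite !big_geq.
rewrite [RHS]big_ltn//= derivC horner0 add0r.
by apply: eq_bigr => j _; rewrite derivXn hornerMn hornerXn mulr_natl.
Qed.

(* Main.v *)
(* Write a function of the Bergman space as f = sum a_n z^n.  Up to constants its
   squared norm is sum |a_n|^2 / (n+1)^2, and f_k has the coefficients
   1 - v_k(n), where v_k(n) = k if k divides n+1 and v_k(n) = 0 otherwise; so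
   f_k = v_1 - v_k.  In the average of f_{2^i} over i <= L the v-part tends to 0,
   because the v_{2^i} are almost orthogonal; hence v_1, and then every v_k, lies
   in the closed span.  Let w_{r,k} keep of v_k only the n for which (n+1)/k has
   no prime factor <= r.  Then w_{p,k} = w_{p-1,k} - p^-1 w_{p-1,kp} for p prime,
   so all w_{r,k} lie in the closed span, and w_{r,k} tends to k z^(k-1).
   So all monomials lie in the closed span.

   It remains to link functions and coefficients.  A function that is locally a
   power series on the disk is globally one: if its Taylor series at 0 had
   radius rho < 1, the Cauchy estimates at the points |w| < rho, uniform by
   compactness, would bound the coefficients beyond rho.  The monomials are
   orthogonal because the area measure is invariant under rotations, which are
   products of shears, and their norms follow from dilation invariance. *)

(* Analyticity is given only as local convergence of power series, so averages over roots of unity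
   take the place of contour integrals: the discrete Parseval identity [prim_root_parseval] gives
   both Cauchy's estimate and, with rotation invariance, the orthogonality of the monomials. Density
   is insensitive to replacing the norm by an equivalent one. The weight 1/(n+1)^2 is convenient
   because, with n + 1 = k m, the entry k/(n+1) of v_k becomes 1/m, so that all v_k have the same
   norm. Near orthogonality is used for each n separately: the nonzero values v_{2^i}(n) are
   distinct powers of two, so the square of their sum is at most 4 times the sum of their squares,
   and an average of L of them has squared norm O(1/L). Between functions and coefficients two
   one-sided facts suffice: a small coefficient norm makes the Bergman norm small (Fatou), and a
   finite Bergman norm makes the coefficient norm finite (dilation to a smaller disk). *)
Require Import Defs.
From HB Require Import structures.
From mathcomp Require Import all_boot all_order all_algebra.
From mathcomp Require Import complex all_solvable all_field.
From mathcomp Require Import all_classical all_reals all_analysis.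
From mathcomp Require Import measurable_realfun.
From mathcomp Require Import ring lra zify.
Set Implicit Arguments.
Unset Strict Implicit.
Unset Printing Implicit Defensive.

Import Order.TTheory GRing.Theory Num.Theory.
Import numFieldNormedType.Exports.

Local Open Scope classical_set_scope.
Local Open Scope ring_scope.

(** * The real-valued modulus *)

Section nm.
Variable R : realType.
Implicit Types z w : cplx R.

(* The norm of cplx R takes values in cplx R; nm is the same norm in R. *)
Definition nm z : R := complex.Re `|z|.

Lemma normE z : `|z| = Complex (nm z) 0.
Proof. by case: z => a b; rewrite /nm. Qed.

Lemma nm_sq z : nm z ^+ 2 = complex.Re z ^+ 2 + complex.Im z ^+ 2.
Proof.
case: z => a b; rewrite /nm /= sqr_sqrtr //.
by rewrite addr_ge0 ?sqr_ge0.
Qed.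

Lemma nm_ge0 z : 0 <= nm z.
Proof. by case: z => a b; rewrite /nm /= sqrtr_ge0. Qed.

Lemma nmM z w : nm (z * w) = nm z * nm w.
Proof. by rewrite {1}/nm normrM !normE /= mulr0 subr0. Qed.

Lemma nmD z w : nm (z + w) <= nm z + nm w.
Proof. by have := ler_normD z w; rewrite !normE lecE /= => /andP[]. Qed.

Lemma nm0 : nm 0 = 0.
Proof. by rewrite /nm normr0. Qed.

Lemma nm1 : nm 1 = 1.
Proof. by rewrite /nm normr1. Qed.

Lemma nm_eq0 z : (nm z == 0) = (z == 0).
Proof. by rewrite -[RHS]normr_eq0 normE eq_complex /= eqxx andbT. Qed.

Lemma nmN z : nm (- z) = nm z.
Proof. by rewrite /nm normrN. Qed.

Lemma nmX z n : nm (z ^+ n) = nm z ^+ n.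
Proof.
by elim: n => [|n IH]; rewrite ?expr0 ?nm1// !exprS nmM IH.
Qed.

Lemma nm_nat n : nm (n%:R) = n%:R.
Proof.
rewrite /nm normr_nat; elim: n => // n IH.
by rewrite -!natr1 raddfD /= IH.
Qed.

Lemma nmV z : nm z^-1 = (nm z)^-1.
Proof.
have [->|z0] := eqVneq z 0; first by rewrite invr0 nm0 invr0.
have nz : nm z != 0 by rewrite nm_eq0.
by apply: (mulfI nz); rewrite -nmM !divff// nm1.
Qed.

Lemma nm_real (x : R) : nm (Complex x 0) = `|x|.
Proof. by rewrite /nm /= expr0n addr0 sqrtr_sqr. Qed.

Lemma nm_sum (I : Type) (r : seq I) (P : pred I) (F : I -> cplx R) :
  nm (\sum_(i <- r | P i) F i) <= \sum_(i <- r | P i) nm (F i).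
Proof.
elim/big_ind2 : _ => //; first by rewrite nm0.
by move=> a b c d ab cd; apply: le_trans (nmD _ _) (lerD _ _).
Qed.

Lemma nm_sqD z w : nm (z + w) ^+ 2 <= 2 * nm z ^+ 2 + 2 * nm w ^+ 2.
Proof.
have := nmD z w; have := nm_ge0 (z + w); have := nm_ge0 z; have := nm_ge0 w.
set a := nm z; set b := nm w; set c := nm _ => a0 b0 c0 cab.
have : c ^+ 2 <= (a + b) ^+ 2 by rewrite lerXn2r ?nnegrE// addr_ge0.
have := sqr_ge0 (a - b); nra.
Qed.

Lemma Re_le_nm z : `|complex.Re z| <= nm z.
Proof.
rewrite -(ler_pXn2r (n := 2)) ?nnegrE ?nm_ge0//.
by rewrite nm_sq real_normK ?num_real// lerDl sqr_ge0.
Qed.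

Lemma Im_le_nm z : `|complex.Im z| <= nm z.
Proof.
rewrite -(ler_pXn2r (n := 2)) ?nnegrE ?nm_ge0//.
by rewrite nm_sq real_normK ?num_real// lerDr sqr_ge0.
Qed.

Lemma nm_le_ReIm z : nm z <= `|complex.Re z| + `|complex.Im z|.
Proof.
rewrite -(ler_pXn2r (n := 2)) ?nnegrE ?nm_ge0 ?addr_ge0//.
rewrite nm_sq sqrrD !real_normK ?num_real//.
by have := normr_ge0 (complex.Re z); have := normr_ge0 (complex.Im z); nra.
Qed.

Lemma norm_lt_nm z (e : R) : (`|z| < Complex e 0) = (nm z < e).
Proof. by rewrite normE ltcE /= eqxx. Qed.

Lemma unit_diskE z : unit_disk z = (nm z < 1).
Proof. by rewrite /unit_disk/= -norm_lt_nm. Qed.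

End nm.

(** * Approximation in the space of coefficients *)

Section coefficient_space.
Variable R : realType.
Implicit Types a b : nat -> cplx R.

(** [B] bounds the squared norm. Bounding all partial sums avoids speaking of the value of an
    infinite sum. *)
Definition l2bounded a (B : R) :=
  forall N, \sum_(0 <= n < N) nm (a n) ^+ 2 / n.+1%:R ^+ 2 <= B.

(** These are the Taylor coefficients of k z^(k-1) / (1 - z^k), which is minus the logarithmic
    derivative of 1 - z^k. *)
Definition mult_coef k n : cplx R := if (k %| n.+1)%N then k%:R else 0.

Definition fk_coef k n : cplx R := 1 - mult_coef k n.

Definition span_coef a :=
  exists N (c : nat -> cplx R), forall n, a n = \sum_(2 <= k < N) c k * fk_coef k n.

Definition closure_coef a :=
  forall e : R, 0 < e -> exists2 b, span_coef b & l2bounded (a \- b) e.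

Lemma l2bounded_ge0 a B : l2bounded a B -> 0 <= B.
Proof. by move/(_ 0%N); rewrite big_geq. Qed.

Lemma l2bounded_le a A B : A <= B -> l2bounded a A -> l2bounded a B.
Proof. by move=> AB aA N; apply: le_trans (aA N) AB. Qed.

(** From |x + y|^2 <= 2|x|^2 + 2|y|^2 in each term; the lost factor is the reason for the choices e
    / 4 below. *)
Lemma l2boundedD a b A B :
  l2bounded a A -> l2bounded b B -> l2bounded (a \+ b) (2 * A + 2 * B).
Proof.
move=> aA bB N; apply: (@le_trans _ _ (\sum_(0 <= n < N)
  (2 * (nm (a n) ^+ 2 / n.+1%:R ^+ 2) + 2 * (nm (b n) ^+ 2 / n.+1%:R ^+ 2)))).
  apply: ler_sum => n _; rewrite -mulrDr -mulrDl [leRHS]mulrA.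
  by rewrite ler_wpM2r ?invr_ge0 ?sqr_ge0// mulrDr nm_sqD.
by rewrite big_split/= -!mulr_sumr lerD// ler_wpM2l.
Qed.

Lemma l2boundedZ a c A :
  l2bounded a A -> l2bounded (fun n => c * a n) (nm c ^+ 2 * A).
Proof.
move=> aA N; rewrite (eq_bigr (fun n =>
  nm c ^+ 2 * (nm (a n) ^+ 2 / n.+1%:R ^+ 2))); last first.
  by move=> n _; rewrite nmM exprMn mulrA.
by rewrite -mulr_sumr ler_wpM2l ?sqr_ge0.
Qed.

Lemma l2bounded0 : l2bounded (fun=> 0) 0.
Proof. by move=> N; rewrite big1// => n _; rewrite nm0 expr0n mul0r. Qed.

Lemma span_coef0 : span_coef (fun=> 0).
Proof. by exists 0%N, (fun=> 0) => n; rewrite big_geq. Qed.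

Lemma span_coefD a b : span_coef a -> span_coef b -> span_coef (a \+ b).
Proof.
have widen c (N M : nat) n : (N <= M)%N ->
    \sum_(2 <= k < N) c k * fk_coef k n =
    \sum_(2 <= k < M) (if (k < N)%N then c k else 0) * fk_coef k n.
  move=> NM; rewrite (big_nat_widen _ _ M)// big_mkcond/=; apply: eq_bigr => k _.
  by case: ifP; rewrite ?mul0r.
move=> [N [c ca]] [M [d db]].
exists (maxn N M), (fun k => (if (k < N)%N then c k else 0) +
                           (if (k < M)%N then d k else 0)) => n.
rewrite /= ca db (widen c N (maxn N M)) ?leq_maxl//.
rewrite (widen d M (maxn N M)) ?leq_maxr// -big_split/=.
by apply: eq_bigr => k _; rewrite mulrDl.
Qed.

Lemma span_coefZ x a : span_coef a -> span_coef (fun n => x * a n).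
Proof.
move=> [N [c ca]]; exists N, (fun k => x * c k) => n.
by rewrite ca mulr_sumr; apply: eq_bigr => k _; rewrite mulrA.
Qed.

Lemma span_coef_sum (I : Type) (r : seq I) (F : I -> nat -> cplx R) :
  (forall i, span_coef (F i)) -> span_coef (fun n => \sum_(i <- r) F i n).
Proof.
move=> sF; elim: r => [|i r IH].
  by rewrite (_ : (fun _ => _) = fun=> 0) ?funeqE => [|n]; rewrite ?big_nil//;
    exact: span_coef0.
rewrite (_ : (fun _ => _) = F i \+ (fun n => \sum_(i <- r) F i n)).
  exact: span_coefD.
by apply/funext => n; rewrite big_cons.
Qed.

Lemma span_coef_fk k : (1 < k)%N -> span_coef (fk_coef k).
Proof.
move=> k1; exists k.+1, (fun j => (j == k)%:R) => n.
rewrite big_nat_recr//= eqxx mul1r big_nat big1 ?add0r// => i /andP[_ ik].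
by rewrite ltn_eqF// mul0r.
Qed.

Lemma span_closure a : span_coef a -> closure_coef a.
Proof.
move=> sa e e0; exists a => //; apply: l2bounded_le (ltW e0) _.
rewrite (_ : _ \- _ = fun=> 0); first exact: l2bounded0.
by apply/funext => n /=; rewrite subrr.
Qed.

Lemma closure_coef_lim a :
  (forall e : R, 0 < e -> exists2 b, closure_coef b & l2bounded (a \- b) e) ->
  closure_coef a.
Proof.
move=> ha e e0; have e4 : 0 < e / 4 by rewrite divr_gt0.
have [b cb ab] := ha _ e4; have [c sc bc] := cb _ e4; exists c => //.
rewrite (_ : a \- c = (a \- b) \+ (b \- c)); last first.
  by apply/funext => n /=; rewrite addrA subrK.
by apply: l2bounded_le (l2boundedD ab bc); lra.
Qed.

Lemma closure_coefD a b : closure_coef a -> closure_coef b -> closure_coef (a \+ b).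
Proof.
move=> ca cb e e0; have e4 : 0 < e / 4 by rewrite divr_gt0.
have [a' sa aa] := ca _ e4; have [b' sb bb] := cb _ e4.
exists (a' \+ b'); first exact: span_coefD.
rewrite (_ : _ \- _ = (a \- a') \+ (b \- b')); last first.
  by apply/funext => n /=; rewrite opprD addrACA.
by apply: l2bounded_le (l2boundedD aa bb); lra.
Qed.

Lemma closure_coefZ x a : closure_coef a -> closure_coef (fun n => x * a n).
Proof.
(* The added 1 keeps the divisor positive when x = 0. *)
move=> ca e e0; have x0 : 0 < nm x ^+ 2 + 1 by rewrite ltr_wpDl ?sqr_ge0.
have [b sb ab] := ca (e / (nm x ^+ 2 + 1)) (divr_gt0 e0 x0).
exists (fun n => x * b n); first exact: span_coefZ.
rewrite (_ : _ \- _ = fun n => x * (a \- b) n); last first.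
  by apply/funext => n /=; rewrite mulrBr.
apply: l2bounded_le (l2boundedZ x ab).
by rewrite mulrCA ler_piMr ?(ltW e0)// ler_pdivrMr// mul1r lerDl.
Qed.

(** * Weighted sums over multiples *)

Lemma sum_multiples (F : nat -> R) k N : (0 < k)%N ->
  \sum_(0 <= n < N) (if (k %| n.+1)%N then F (n.+1 %/ k)%N else 0) =
  \sum_(1 <= m < (N %/ k).+1) F m.
Proof.
move=> k0; elim: N => [|N IH]; first by rewrite div0n !big_geq.
rewrite big_nat_recr//= IH divnS//; case: (boolP (k %| N.+1)%N) => kN;
  last by rewrite add0n addr0.
by rewrite add1n [RHS]big_nat_recr.
Qed.

(** The right side is 1/(m(m+1)); it telescopes when summed. *)
Lemma inv_sq_le (m : R) : 0 < m -> 1 / (m + 1) ^+ 2 <= m^-1 - (m + 1)^-1.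
Proof.
move=> m0; have m1 : m + 1 != 0 by rewrite gt_eqF// ltr_wpDr.
rewrite -subr_ge0 (_ : _ - _ = (m * (m + 1) ^+ 2)^-1).
  by rewrite invr_ge0 mulr_ge0 ?sqr_ge0// ltW.
by field; rewrite m1 gt_eqF.
Qed.

Lemma sum_inv_sq_tail r M : (0 < r)%N ->
  \sum_(1 <= m < M) (if (r < m)%N then 1 / m%:R ^+ 2 else 0) <= r%:R^-1 :> R.
Proof.
move=> r0; have [Mr|rM] := leqP M r.+1.
  rewrite big_nat big1 ?invr_ge0// => m /andP[_ mM].
  by rewrite ltnNge -ltnS (leq_trans mM Mr).
(* Keeping the subtracted end of the telescoping sum makes the induction on M go through. *)
suff : \sum_(1 <= m < M) (if (r < m)%N then 1 / m%:R ^+ 2 else 0) <=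
    r%:R^-1 - M.-1%:R^-1 :> R.
  by move=> /le_trans -> //; rewrite gerBl invr_ge0.
rewrite -(subnKC rM); elim: (M - r.+2)%N => [|d IH].
  rewrite addn0 big_nat_recr//= big_nat big1 ?add0r; last first.
    by move=> m /andP[_ mM]; rewrite ltnNge -ltnS mM.
  by rewrite ltnSn -natr1 inv_sq_le// ltr0n.
rewrite addnS big_nat_recr//=.
rewrite ifT; last by lia.
apply: le_trans (lerD IH (lexx _)) _.
have := inv_sq_le (m := (r + d).+1%:R) (ltr0Sn _ _).
rewrite !addSn/= natr1 => h; rewrite -addrA lerD2l.
by apply: le_trans (lerD (lexx _) h) _; rewrite addrA addNr add0r.
Qed.

Lemma sum_inv_sq M : \sum_(1 <= m < M) 1 / m%:R ^+ 2 <= 2 :> R.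
Proof.
case: M => [|[|M]]; [by rewrite big_geq | by rewrite big_geq |].
rewrite big_ltn// expr1n divr1 -[leRHS]/(1 + 1)%R lerD2l.
have := sum_inv_sq_tail M.+2 (ltn0Sn 0); rewrite invr1; apply: le_trans.
rewrite [leRHS]big_ltn//= add0r !big_nat.
by apply: ler_sum => m /andP[m1 _]; rewrite m1.
Qed.

Lemma l2bounded_multiples a k (F : nat -> R) B : (0 < k)%N ->
  (forall n, nm (a n) ^+ 2 / n.+1%:R ^+ 2 <=
    if (k %| n.+1)%N then F (n.+1 %/ k)%N else 0) ->
  (forall M, \sum_(1 <= m < M) F m <= B) -> l2bounded a B.
Proof.
move=> k0 aF FB N; apply: le_trans (FB (N %/ k).+1).
by rewrite -sum_multiples//; apply: ler_sum => n _.
Qed.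

Lemma divSn_natr k n : (0 < k)%N -> (k %| n.+1)%N ->
  k%:R / n.+1%:R = 1 / (n.+1 %/ k)%:R :> R.
Proof.
move=> k0 kn; rewrite -{1}(divnK kn) natrM.
have : (0 < n.+1 %/ k)%N by rewrite divn_gt0// dvdn_leq.
rewrite -!(ltr_nat R) => d0; field; rewrite !gt_eqF//.
by rewrite ltr0n.
Qed.

(** With n + 1 = k m the terms are 1/m^2, so the bound is uniform in k; the averaging argument
    depends on this uniformity. *)
Lemma mult_coef_bounded k : (0 < k)%N -> l2bounded (mult_coef k) 2.
Proof.
move=> k0; apply: (l2bounded_multiples (F := fun m => 1 / m%:R ^+ 2) k0) => [n|].
  rewrite /mult_coef; case: ifP => kn; last by rewrite nm0 expr0n mul0r.
  by rewrite nm_nat -expr_div_n divSn_natr// expr_div_n expr1n.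
exact: sum_inv_sq.
Qed.

(** A sum of distinct powers of two is at most twice the largest one, so its square is controlled by
    the largest square alone. This is the near orthogonality of the v_{2^i}. *)
Lemma sum_pow2_sq (x : nat -> bool) L :
  (\sum_(0 <= i < L) (if x i then 2 ^+ i.+1 else 0)) ^+ 2 <=
  4 * \sum_(0 <= i < L) (if x i then (2 ^+ i.+1) ^+ 2 else 0) :> R.
Proof.
(* The linear bound S <= 2p, with p = 2^L, absorbs the cross term: (S + 2p)^2 <= S^2 + 12 p^2 <= S^2
   + 4 (2p)^2. *)
suff : 0 <= \sum_(0 <= i < L) (if x i then 2 ^+ i.+1 else 0 : R) <= 2 * 2 ^+ L /\
  (\sum_(0 <= i < L) (if x i then 2 ^+ i.+1 else 0)) ^+ 2 <=
  4 * \sum_(0 <= i < L) (if x i then (2 ^+ i.+1) ^+ 2 else 0) :> R by case.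
elim: L => [|L [/andP[IH0 IH1] IH2]].
  by rewrite !big_geq// expr0n mulr0 !lexx expr0 mulr1 ler0n.
rewrite !big_nat_recr//=; set S := \sum_(0 <= i < L) _ in IH0 IH1 IH2 *.
set T := \sum_(0 <= i < L) _ in IH2 *.
have : 0 < 2 ^+ L :> R by rewrite exprn_gt0.
rewrite exprS; set p := 2 ^+ L in IH1 *.
case: (x L) => p0; last by split; [lra | rewrite !addr0].
by split; [lra | nra].
Qed.

Lemma closure_mult_coef1 : closure_coef (mult_coef 1).
Proof.
(* The average of l vectors v_{2^i} will have squared norm at most l^-2 * 4 * (2 l) = 8 / l: the 4
   is from [sum_pow2_sq], the 2 from [mult_coef_bounded]. *)
move=> e e0; have [L0 L0e] : exists L, 8 / e < L%:R.
  by exists (Num.truncn (8 / e)).+1; apply: truncnS_gt.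
case: L0 L0e => [|L].
  by rewrite ltNge ltW// divr_gt0.
rewrite ltr_pdivrMr//; set l : R := L.+1%:R => le8.
have l0 : 0 < l by rewrite ltr0n.
(* The exponents start at 1 because the span contains only indices k >= 2. *)
exists (fun n => L.+1%:R^-1 * \sum_(0 <= i < L.+1) fk_coef (2 ^ i.+1) n).
  apply: span_coefZ; apply: span_coef_sum => i; apply: span_coef_fk.
  by rewrite -{1}(expn0 2) ltn_exp2l.
have l0C : L.+1%:R != 0 :> cplx R by rewrite pnatr_eq0.
rewrite (_ : _ \- _ = fun n => L.+1%:R^-1 *
    \sum_(0 <= i < L.+1) mult_coef (2 ^ i.+1) n); last first.
  apply/funext => n /=; rewrite /fk_coef sumrB mulrBr opprB.
  rewrite sumr_const_nat subn0 mulrC (mulVf l0C).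
  by rewrite /mult_coef dvd1n addrCA subrr addr0 mulrC.
apply: (@l2bounded_le _ (nm (L.+1%:R^-1 : cplx R) ^+ 2 * (4 * (l * 2)))).
  rewrite nmV nm_nat -/l exprVn mulrC ler_pdivrMr ?exprn_gt0//.
  by have := ltW le8; rewrite -(ler_pM2r l0); lra.
apply: l2boundedZ => N.
apply: (@le_trans _ _ (4 * \sum_(0 <= i < L.+1) \sum_(0 <= n < N)
   nm (mult_coef (2 ^ i.+1) n) ^+ 2 / n.+1%:R ^+ 2)); last first.
  rewrite ler_wpM2l//; apply: (@le_trans _ _ (\sum_(0 <= i < L.+1) 2)).
    by apply: ler_sum => i _; apply: mult_coef_bounded; rewrite expn_gt0.
  by rewrite sumr_const_nat subn0 -[leLHS]mulr_natl.
rewrite exchange_big/= mulr_sumr; apply: ler_sum => n _.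
rewrite -mulr_suml mulrA ler_wpM2r ?invr_ge0 ?sqr_ge0//.
pose x i := (2 ^ i.+1 %| n.+1)%N.
have -> : \sum_(0 <= i < L.+1) nm (mult_coef (2 ^ i.+1) n) ^+ 2 =
    \sum_(0 <= i < L.+1) (if x i then (2 ^+ i.+1) ^+ 2 else 0).
  apply: eq_bigr => i _; rewrite /mult_coef /x; case: ifP => _.
    by rewrite nm_nat natrX.
  by rewrite nm0 expr0n.
apply: le_trans (sum_pow2_sq x L.+1).
rewrite lerXn2r ?nnegrE ?nm_ge0//.
  by apply: sumr_ge0 => i _; case: ifP => // _; rewrite exprn_ge0.
apply: le_trans (nm_sum _ _ _) _; apply: ler_sum => i _.
by rewrite /mult_coef -/(x i); case: (x i); rewrite ?nm0 ?nm_nat ?natrX.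
Qed.

Lemma closure_mult_coef k : (0 < k)%N -> closure_coef (mult_coef k).
Proof.
move=> k0; have [k1|] := ltnP 1 k; last first.
  by move=> k1; rewrite (_ : k = 1%N); [exact: closure_mult_coef1 | lia].
rewrite (_ : mult_coef k = mult_coef 1 \+ (fun n => -1 * fk_coef k n)).
  apply: closure_coefD; first exact: closure_mult_coef1.
  by apply: closure_coefZ; apply: span_closure; exact: span_coef_fk.
by apply/funext => n; rewrite /= /fk_coef /mult_coef dvd1n mulN1r opprB addrC subrK.
Qed.

(** * Sieving out the small primes *)

Definition rough r m := all (fun p => r < p)%N (primes m).

(** The least prime factor of m lies above r. The exception m = 1 has no prime factors and is rough
    for every r, so it is what survives the sieve. *)
Lemma rough_gt r m : rough r m -> (1 < m)%N -> (r < m)%N.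
Proof.
move=> /allP rm m1; have /rm : pdiv m \in primes m.
  by rewrite mem_primes pdiv_prime// pdiv_dvd (ltn_trans _ m1).
by move/leq_trans; apply; apply: dvdn_leq (pdiv_dvd m); exact: ltn_trans m1.
Qed.

Lemma rough_notprime r m : ~~ prime r.+1 -> rough r.+1 m = rough r m.
Proof.
move=> npr; apply: eq_in_all => p; rewrite mem_primes => /and3P[pp _ _].
rewrite [RHS]leq_eqVlt; case: eqP => [rp|//]; by rewrite rp pp in npr.
Qed.

Lemma rough_prime r m : prime r.+1 -> (0 < m)%N ->
  rough r.+1 m = rough r m && ~~ (r.+1 %| m)%N.
Proof.
move=> pr m0; apply/allP/andP => [rm|[/allP rm ndvd] p pm].
  split; first by apply/allP => p /rm; exact: ltn_trans.
  apply/negP => dm; have /rm : r.+1 \in primes m by rewrite mem_primes pr m0.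
  by rewrite ltnn.
rewrite ltn_neqAle rm// andbT; apply: contra ndvd => /eqP ->.
by move: pm; rewrite mem_primes => /and3P[].
Qed.

Lemma rough_primeM r m : prime r.+1 -> (0 < m)%N -> rough r (r.+1 * m) = rough r m.
Proof.
move=> pr m0; apply/allP/allP => rm p.
  by move=> pm; apply: rm; rewrite primesM// pm orbT.
by rewrite primesM// => /orP[|/rm//]; rewrite primes_prime// inE => /eqP ->.
Qed.

Definition rough_coef r k n : cplx R :=
  if (k %| n.+1)%N && rough r (n.+1 %/ k) then k%:R else 0.

(** Let p = r + 1 and n + 1 = k m. The terms to remove are those with m rough and p | m. As p is
    itself rough at level r, they are exactly the support of [rough_coef r (k * p)], where the value
    k p has to be scaled down to k. *)
Lemma rough_coef_prime r k : prime r.+1 -> (0 < k)%N ->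
  rough_coef r.+1 k = rough_coef r k \+ (fun n => - r.+1%:R^-1 * rough_coef r (k * r.+1) n).
Proof.
move=> pr k0; apply/funext => n; rewrite /= /rough_coef.
have [kn|kn] := boolP (k %| n.+1)%N; last first.
  rewrite (_ : (k * r.+1 %| n.+1)%N = false) ?mulr0 ?addr0//.
  by apply/negbTE; apply: contra kn; apply: dvdn_trans; rewrite dvdn_mulr.
have m0 : (0 < n.+1 %/ k)%N by rewrite divn_gt0// dvdn_leq.
rewrite /= rough_prime// (mulnC k) -dvdn_divRL// (mulnC r.+1) divnMA.
have [rn|rn] := boolP (r.+1 %| n.+1 %/ k)%N; last by rewrite andbT mulr0 addr0.
have q0 : (0 < n.+1 %/ k %/ r.+1)%N by rewrite divn_gt0// dvdn_leq.
have := rough_primeM pr q0; rewrite mulnC divnK// => <-; rewrite andbF.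
case: ifP => _; last by rewrite mulr0 addr0.
by rewrite (mulnC k) natrM mulNr mulKf ?subrr ?pnatr_eq0.
Qed.

Lemma closure_rough_coef r k : (0 < k)%N -> closure_coef (rough_coef r k).
Proof.
elim: r k => [|r IH] k k0.
  rewrite (_ : rough_coef 0 k = mult_coef k); first exact: closure_mult_coef.
  apply/funext => n; rewrite /rough_coef /mult_coef (_ : rough _ _) ?andbT//.
  by apply/allP => p; rewrite mem_primes => /and3P[/prime_gt0].
have [pr|npr] := boolP (prime r.+1).
  rewrite rough_coef_prime//; apply: closure_coefD; first exact: IH.
  by apply: closure_coefZ; apply: IH; rewrite muln_gt0 k0.
rewrite (_ : rough_coef r.+1 k = rough_coef r k); first exact: IH.
by apply/funext => n; rewrite /rough_coef rough_notprime.
Qed.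

Lemma closure_monomial j : closure_coef (fun n => (n == j)%:R).
Proof.
(* The sieved sequences for k = j + 1 converge to j + 1 times the monomial, hence the
   normalization. *)
rewrite (_ : (fun _ => _) = fun n => j.+1%:R^-1 * (if n == j then j.+1%:R else 0));
  last first.
  apply/funext => n; case: eqP => _; last by rewrite mulr0.
  by rewrite mulVf// pnatr_eq0.
apply/closure_coefZ/closure_coef_lim => e e0.
have [r re] : exists r, e^-1 < r.+1%:R.
  by exists (Num.truncn e^-1); apply: truncnS_gt.
exists (rough_coef r.+1 j.+1); first exact: closure_rough_coef.
apply: (@l2bounded_le _ (r.+1%:R^-1)).
  by rewrite -[leRHS]invrK lef_pV2 ?posrE ?invr_gt0// ltW.
(* The error lives on n + 1 = (j + 1) m with m rough and m <> 1, hence m > r + 1, and a tail of the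
   sum of 1/m^2 bounds it. *)
apply: (l2bounded_multiples (k := j.+1) (F := fun m => if (r.+1 < m)%N then 1 / m%:R ^+
  2 else 0)) => //; last first.
  by move=> M; exact: sum_inv_sq_tail.
move=> n; rewrite /= /rough_coef; have [->|nj] := eqVneq n j.
  by rewrite dvdnn divnn/= subrr nm0 expr0n mul0r.
rewrite sub0r; have [kn/=|kn] := boolP (j.+1 %| n.+1)%N; last first.
  by rewrite oppr0 nm0 expr0n mul0r.
case: ifP => [rg|_]; last by rewrite oppr0 nm0 expr0n mul0r; case: ifP => // _;
  rewrite divr_ge0 ?sqr_ge0.
rewrite rough_gt//.
  by rewrite nmN nm_nat -expr_div_n divSn_natr// expr_div_n expr1n.
(* A cofactor equal to 1 would force n = j. *)
have : (0 < n.+1 %/ j.+1)%N by rewrite divn_gt0// dvdn_leq.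
rewrite leq_eqVlt => /orP[/eqP n1|//]; move: (divnK kn); rewrite -n1 mul1n => -[] jn.
by rewrite jn eqxx in nj.
Qed.

Lemma closure_finite a N : (forall n, (N <= n)%N -> a n = 0) -> closure_coef a.
Proof.
elim: N a => [|N IH] a aN.
  by apply: span_closure; rewrite (_ : a = fun=> 0);
    [exact: span_coef0 | apply/funext => n; exact: aN].
rewrite (_ : a = (fun n => if n == N then 0 else a n) \+ (fun n => a N * (n == N)%:R)).
  apply: closure_coefD; last by apply: closure_coefZ; exact: closure_monomial.
  by apply: IH => n; rewrite leq_eqVlt => /orP[/eqP <-|/aN ->]; rewrite ?eqxx// if_same.
by apply/funext => n /=; case: eqP => [->|_]; rewrite ?mulr1 ?add0r// mulr0 addr0.
Qed.

Lemma closure_coef_full a B : l2bounded a B -> closure_coef a.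
Proof.
move=> aB; apply: closure_coef_lim => e e0.
(* Truncate where a partial sum comes within e of the supremum: every later block of terms is then
   below e. *)
pose S := [set \sum_(0 <= n < N) nm (a n) ^+ 2 / n.+1%:R ^+ 2 | N in setT].
have hS : has_sup S.
  split; first by exists (\sum_(0 <= n < 0) nm (a n) ^+ 2 / n.+1%:R ^+ 2), 0%N.
  by exists B => _ [N _ <-].
have [_ [N _ <-] supN] := sup_adherent e0 hS.
exists (fun n => if (n < N)%N then a n else 0).
  by apply: (@closure_finite _ N) => n; rewrite leqNgt => /negbTE ->.
move=> M; pose K := maxn M N.
have term_ge0 n : 0 <= nm (a n) ^+ 2 / n.+1%:R ^+ 2 by rewrite divr_ge0 ?sqr_ge0.
apply: (@le_trans _ _ (\sum_(N <= n < K) nm (a n) ^+ 2 / n.+1%:R ^+ 2)).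
  rewrite (big_nat_widen _ _ K) ?leq_maxl// [leLHS]big_mkcond.
  rewrite (big_cat_nat (n := N)) ?leq_maxr//= [X in X + _]big_nat big1 ?add0r.
    rewrite !big_nat; apply: ler_sum => n /andP[Nn _].
    by case: ifP => // _; rewrite ltnNge Nn subr0.
  by move=> n /andP[_ ->]; rewrite subrr nm0 expr0n mul0r if_same.
have : \sum_(0 <= n < K) nm (a n) ^+ 2 / n.+1%:R ^+ 2 <= sup S.
  by apply: sup_upper_bound => //; exists K.
rewrite (big_cat_nat (n := N)) ?leq_maxr//=.
move: supN; set u := \sum_(0 <= n < N) _; set v := \sum_(N <= n < K) _.
by lra.
Qed.

End coefficient_space.

(** * Complex series and recentering of power series *)

Section power_series.
Variable R : realType.
Implicit Types (x y u a b c : nat -> cplx R) (z w h l : cplx R).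

(** Convergence is phrased through real distances, so that squeezing and order arguments take place
    in [R]; [ccvgP] relates it to the topology of [cplx R]. *)
Definition ccvg x l := (fun N => nm (x N - l)) @ \oo --> (0 : R).

Definition csum u l := ccvg (fun N => \sum_(0 <= n < N) u n) l.

(** A quantitative substitute for a radius of convergence at least t: convergence at one point of
    modulus t implies it, and it gives geometric domination at every smaller modulus. *)
Definition coef_bounded a (t M : R) := forall n, nm (a n) * t ^+ n <= M.

Lemma cvgD0 (e f : nat -> R) : e @ \oo --> (0 : R) -> f @ \oo --> (0 : R) ->
  (fun N => e N + f N) @ \oo --> (0 : R).
Proof. by move=> e0 f0; rewrite -[X in _ --> X](addr0 (0 : R)); exact: cvgD. Qed.

Lemma cvgZ0 (c : R) (e : nat -> R) : e @ \oo --> (0 : R) ->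
  (fun N => c * e N) @ \oo --> (0 : R).
Proof. by move=> e0; rewrite -[X in _ --> X](mulr0 c); exact: cvgMr. Qed.

Lemma ccvg_squeeze x l (e : nat -> R) :
  e @ \oo --> (0 : R) -> (forall N, nm (x N - l) <= e N) -> ccvg x l.
Proof.
move=> e0 xe; apply: (squeeze_cvgr _ (cvg_cst 0) e0).
by near=> N; rewrite nm_ge0 xe.
Unshelve. all: by end_near. Qed.

Lemma ccvgP x l : ccvg x l <-> x @ \oo --> l.
Proof.
split=> [/cvgr0Pnorm_lt xl|xl].
  apply/cvgrPdist_lt => e e0.
  have e0' : 0 < complex.Re e by move: e0; rewrite ltcE /= => /andP[].
  (* In the order of [cplx R] a positive element is real. *)
  rewrite (_ : e = Complex (complex.Re e) 0); last first.
    by move: e0; rewrite ltcE /= => /andP[/eqP] ; case: e {e0'} => ? ? /= ->.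
  apply: filterS (xl _ e0') => N.
  by rewrite distrC norm_lt_nm ger0_norm ?nm_ge0.
apply/cvgr0Pnorm_lt => e e0; move/cvgrPdist_lt : xl => /(_ (Complex e 0)).
rewrite ltcE /= eqxx => /(_ e0); apply: filterS => N.
by rewrite distrC norm_lt_nm ger0_norm ?nm_ge0.
Qed.

Lemma ccvg_cst l : ccvg (fun=> l) l.
Proof.
by apply: (ccvg_squeeze (cvg_cst 0)) => N; rewrite subrr nm0.
Qed.

Lemma ccvgD x y l w : ccvg x l -> ccvg y w -> ccvg (x \+ y) (l + w).
Proof.
move=> xl yw; have := cvgD0 xl yw; move=> /ccvg_squeeze; apply => N /=.
by rewrite opprD addrACA nmD.
Qed.

Lemma ccvgZ x l z : ccvg x l -> ccvg (fun N => z * x N) (z * l).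
Proof.
move=> xl; have := cvgZ0 (nm z) xl; move=> /ccvg_squeeze; apply => N /=.
by rewrite -mulrBr nmM.
Qed.

Lemma ccvg_le x l w (K : R) : ccvg x l -> (\forall N \near \oo, nm (x N - w) <= K) ->
  nm (l - w) <= K.
Proof.
move=> xl xK; rewrite -subr_le0 leNgt; apply/negP => d0.
move/cvgr0Pnorm_lt : xl => /(_ _ d0) xl.
have [N [h1 h2]] : exists N, `|nm (x N - l)| < nm (l - w) - K /\ nm (x N - w) <= K.
  near \oo => N; exists N; split; near: N => //.
move: h1; rewrite ger0_norm ?nm_ge0// ltNge => /negP; apply.
rewrite lerBlDr; apply: le_trans (lerD (lexx _) h2).
rewrite -(nmN (x N - l)) opprB; apply: le_trans (nmD _ _).
by rewrite addrA subrK.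
Unshelve. all: by end_near. Qed.

Lemma ccvg_unique x l w : ccvg x l -> ccvg x w -> l = w.
Proof.
move=> xl xw; apply/eqP; rewrite -subr_eq0 -nm_eq0 eq_le nm_ge0 andbT.
apply/ler_addgt0Pr => e e0; rewrite add0r; apply: ccvg_le xl _.
move/cvgr0Pnorm_lt : xw => /(_ _ e0); apply: filterS => N.
by rewrite ger0_norm ?nm_ge0//; exact: ltW.
Qed.

Lemma csumZ u l z : csum u l -> csum (fun n => z * u n) (z * l).
Proof.
move=> /(ccvgZ z); rewrite /csum (_ : (fun N => z * _) = (fun N => \sum_(0 <= n < N) z
  * u n))//.
by apply/funext => N; rewrite mulr_sumr.
Qed.

Lemma csumD u v l w : csum u l -> csum v w -> csum (u \+ v) (l + w).
Proof.
move=> ul vw; have := ccvgD ul vw; rewrite /csum.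
rewrite (_ : (_ \+ _) = fun N => \sum_(0 <= n < N) (u \+ v) n)//.
by apply/funext => N /=; rewrite big_split.
Qed.

Lemma ccvg_sum x (F : nat -> nat -> cplx R) (l : nat -> cplx R) K :
  (forall n, ccvg (F n) (l n)) ->
  ccvg (fun N => \sum_(0 <= n < K) F n N) (\sum_(0 <= n < K) l n).
Proof.
move=> Fl; elim: K => [|K IH].
  rewrite big_geq// (_ : (fun _ => _) = fun=> 0); first exact: ccvg_cst.
  by apply/funext => N; rewrite big_geq.
rewrite big_nat_recr//= (_ : (fun _ => _) =
  (fun N => \sum_(0 <= n < K) F n N) \+ F K); first exact: ccvgD.
by apply/funext => N; rewrite big_nat_recr.
Qed.

Lemma geometric_tail (q : R) N N' : 0 <= q < 1 ->
  \sum_(N <= n < N') q ^+ n <= q ^+ N / (1 - q).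
Proof.
move=> /andP[q0 q1]; have q1' : 0 < 1 - q by rewrite subr_gt0.
have [NN|/ltnW NN] := leqP N' N.
  by rewrite big_geq// divr_ge0 ?exprn_ge0// ltW.
rewrite ler_pdivlMr// -(subnKC NN); elim: (N' - N)%N => [|d IH].
  by rewrite addn0 big_geq// mul0r exprn_ge0.
suff -> : (\sum_(N <= n < N + d.+1) q ^+ n) * (1 - q) = q ^+ N - q ^+ (N + d.+1).
  by rewrite gerBl exprn_ge0.
move=> {IH}; elim: d => [|d IH].
  by rewrite addn1 big_nat1 exprS mulrBr mulr1 mulrC.
rewrite addnS big_nat_recr//=; last by rewrite addnS ltnW// ltnS leq_addr.
by rewrite mulrDl IH addnS !exprS; ring.
Qed.

Lemma dominated_tail u (M q : R) N N' : 0 <= q < 1 ->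
  (forall n, nm (u n) <= M * q ^+ n) ->
  nm (\sum_(N <= n < N') u n) <= M * (q ^+ N / (1 - q)).
Proof.
move=> q01 uM; have M0 : 0 <= M.
  by have := uM 0%N; rewrite expr0 mulr1; apply: le_trans; rewrite nm_ge0.
apply: le_trans (nm_sum _ _ _) _.
apply: (le_trans (ler_sum _ (fun n _ => uM n))).
by rewrite -mulr_sumr ler_wpM2l// geometric_tail.
Qed.

(** Real and imaginary parts converge absolutely as real series; [geo] handles both as additive maps
    dominated by [nm]. *)
Lemma dominated_csum u (M q : R) : 0 <= q < 1 ->
  (forall n, nm (u n) <= M * q ^+ n) -> exists l, csum u l.
Proof.
move=> /andP[q0 q1] uM.
have geo (f : cplx R -> R) : (forall z, `|f z| <= nm z) -> {morph f : z w / z + w >-> z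
  + w} ->
    f 0 = 0 -> cvgn (fun N => f (\sum_(0 <= n < N) u n)).
  move=> fnm fD f0.
  rewrite (_ : (fun _ => _) = series (f \o u)); last first.
    by apply/funext => N; rewrite /series/= (big_morph f fD f0).
  apply: normed_cvg; apply: (@series_le_cvg _ _ (geometric M q)) => [n|n|n|].
  - exact: normr_ge0.
  - by rewrite mulr_ge0 ?exprn_ge0//; apply: le_trans (nm_ge0 (u 0%N)) _;
    rewrite (le_trans (uM 0%N))// expr0 mulr1.
  - exact: le_trans (fnm _) (uM n).
  - by apply: is_cvg_geometric_series; rewrite ger0_norm.
have /cvg_ex[/= r rl] := geo _ (@Re_le_nm R) (raddfD (@complex.Re R)) (raddf0
  (@complex.Re R)).
have /cvg_ex[/= i il] := geo _ (@Im_le_nm R) (raddfD (@complex.Im R)) (raddf0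
  (@complex.Im R)).
exists (Complex r i).
have dist0 (x : nat -> R) (p : R) : x @ \oo --> p -> (fun N => `|x N - p|) @ \oo --> (0
  : R).
  move=> xp; rewrite -[X in _ --> X](normr0 R) -(subrr p).
  by apply: cvg_norm; apply: cvgB => //; exact: cvg_cst.
have := cvgD0 (dist0 _ _ rl) (dist0 _ _ il); move=> /ccvg_squeeze; apply => N /=.
by apply: le_trans (nm_le_ReIm _) _; rewrite !raddfB.
Qed.

Lemma csum_tail u l (M q : R) N : 0 <= q < 1 ->
  (forall n, nm (u n) <= M * q ^+ n) -> csum u l ->
  nm (l - \sum_(0 <= n < N) u n) <= M * (q ^+ N / (1 - q)).
Proof.
move=> q01 uM ul; apply: ccvg_le ul _; near=> N'.
have NN : (N <= N')%N by near: N'; exact: nbhs_infty_ge.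
by rewrite (big_cat_nat (n := N))//= [X in nm X]addrC addKr; exact: dominated_tail.
Unshelve. all: by end_near. Qed.

Lemma geometric_tail_cvg (M q : R) : 0 <= q < 1 ->
  (fun N => M * (q ^+ N / (1 - q))) @ \oo --> (0 : R).
Proof.
move=> /andP[q0 q1]; rewrite -(mulr0 M); apply: cvgMr.
rewrite -(mul0r (1 - q)^-1); apply: cvgMl.
by apply: cvg_expr; rewrite ger0_norm.
Qed.

(** Each term is a difference of consecutive partial sums, and these stay within a fixed distance of
    l. *)
Lemma csum_coef_bounded a z l : csum (fun n => a n * z ^+ n) l ->
  exists M, coef_bounded a (nm z) M.
Proof.
move=> al; have : bounded_fun (fun N => nm (\sum_(0 <= n < N) a n * z ^+ n - l)).
  by apply: cvg_seq_bounded; apply/cvg_ex; exists 0.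
move=> [K [_ /(_ (K + 1))]]; rewrite ltrDl ltr01 => /(_ isT) aK.
have {}aK N : nm (\sum_(0 <= n < N) a n * z ^+ n - l) <= K + 1.
  by have := aK N I; rewrite /= ger0_norm ?nm_ge0.
exists ((K + 1) + (K + 1)) => n; rewrite -nmX -nmM.
apply: le_trans (lerD (aK n.+1) (aK n)).
rewrite -(nmN (\sum_(0 <= i < n) _ - l)); apply: le_trans (nmD _ _).
by rewrite big_nat_recr//= opprB addrA subrK addrAC subrr add0r.
Qed.

Lemma coef_bounded_term a (t M : R) z n : 0 < t -> coef_bounded a t M ->
  nm (a n * z ^+ n) <= M * (nm z / t) ^+ n.
Proof.
move=> t0 aM; rewrite nmM nmX expr_div_n mulrA ler_pdivlMr ?exprn_gt0//.
by rewrite mulrAC ler_wpM2r// exprn_ge0 ?nm_ge0.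
Qed.

Lemma coef_bounded_csum a (t M : R) z : 0 < t -> coef_bounded a t M -> nm z < t ->
  exists l, csum (fun n => a n * z ^+ n) l.
Proof.
move=> t0 aM zt; apply: (@dominated_csum _ M (nm z / t)).
  by rewrite divr_ge0 ?nm_ge0 ?(ltW t0)//= ltr_pdivrMr// mul1r.
by move=> n; exact: coef_bounded_term.
Qed.

Lemma coef_bounded_le a (t t' M M' : R) : 0 <= t -> t <= t' -> M' <= M ->
  coef_bounded a t' M' -> coef_bounded a t M.
Proof.
move=> t0 tt MM aM n; apply: le_trans (le_trans (aM n) MM).
by rewrite ler_wpM2l ?nm_ge0// lerXn2r// nnegrE (le_trans t0).
Qed.

(** * Recentering a power series *)

Lemma binomial_term_le (p s : R) m n : 0 <= p -> 0 <= s ->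
  'C(m, n)%:R * p ^+ (m - n) * s ^+ n <= (p + s) ^+ m.
Proof.
move=> p0 s0; have [nm|mn] := leqP n m; last first.
  by rewrite bin_small// !mul0r exprn_ge0// addr_ge0.
rewrite exprDn (bigD1 (Ordinal (nm : (n < m.+1)%N)))//=.
rewrite -[X in _ <= X + _]mulr_natl mulrA lerDl; apply: sumr_ge0 => i _.
by rewrite mulrn_wge0// mulr_ge0// exprn_ge0.
Qed.

Lemma binomial_sum_le (p s : R) m N : 0 <= p -> 0 <= s ->
  \sum_(0 <= n < N) 'C(m, n)%:R * p ^+ (m - n) * s ^+ n <= (p + s) ^+ m.
Proof.
move=> p0 s0.
have t0 n : 0 <= 'C(m, n)%:R * p ^+ (m - n) * s ^+ n.
  by rewrite !mulr_ge0// exprn_ge0.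
apply: (@le_trans _ _ (\sum_(0 <= n < maxn N m.+1) 'C(m, n)%:R * p ^+ (m - n) * s ^+ n)).
  by rewrite [leRHS](big_cat_nat (n := N)) ?leq_maxl//= lerDl sumr_ge0.
rewrite (big_cat_nat (n := m.+1)) ?leq_maxr//= [X in _ + X]big_nat [X in _ + X]big1 ?addr0.
  rewrite exprDn big_mkord; apply: ler_sum => i _.
  by rewrite -[leRHS]mulr_natl mulrA.
by move=> n /andP[mn _]; rewrite bin_small// !mul0r.
Qed.

(** Here l is the n-th Taylor coefficient at w. For m < n the binomial vanishes, so the truncated
    exponent m - n does no harm. *)
Definition recentered a w n l := csum (fun m => 'C(m, n)%:R * a m * w ^+ (m - n)) l.

Section recenter.
Variables (a : nat -> cplx R) (t M : R) (w : cplx R).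
Hypotheses (t0 : 0 < t) (aM : coef_bounded a t M) (wt : nm w < t).

(** C(m, n) |w|^(m-n) s^n is one term of the expansion of (|w| + s)^m, which gives a domination with
    a ratio independent of n. *)
Let term_le m n (s : R) : 0 <= s ->
  nm ('C(m, n)%:R * a m * w ^+ (m - n)) * s ^+ n <= M * ((nm w + s) / t) ^+ m.
Proof.
move=> s0; rewrite !nmM nmX nm_nat.
rewrite (_ : _ * s ^+ n = nm (a m) * ('C(m, n)%:R * nm w ^+ (m - n) * s ^+ n));
  last by ring.
apply: (@le_trans _ _ (nm (a m) * (nm w + s) ^+ m)).
  by rewrite ler_wpM2l ?nm_ge0// binomial_term_le ?nm_ge0.
rewrite expr_div_n mulrA ler_pdivlMr ?exprn_gt0//.
by rewrite mulrAC ler_wpM2r// exprn_ge0 ?addr_ge0 ?nm_ge0.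
Qed.

Let q_lt1 (s : R) : 0 <= s -> nm w + s < t -> 0 <= (nm w + s) / t < 1.
Proof.
move=> s0 st; rewrite divr_ge0 ?addr_ge0 ?nm_ge0 ?(ltW t0)//=.
by rewrite ltr_pdivrMr// mul1r.
Qed.

Lemma recentered_exists : exists A, forall n, recentered a w n (A n).
Proof.
pose s := (t - nm w) / 2.
have s0 : 0 < s by rewrite divr_gt0// subr_gt0.
suff /choice[A aA] : forall n, exists l, recentered a w n l by exists A.
move=> n.
apply: (@dominated_csum _ (M / s ^+ n) ((nm w + s) / t)).
  by apply: q_lt1; [exact: ltW | have := wt; rewrite /s; lra].
move=> m; rewrite [leRHS]mulrAC ler_pdivlMr ?exprn_gt0//.
exact/term_le/ltW.
Qed.

Variable A : nat -> cplx R.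
Hypothesis aA : forall n, recentered a w n (A n).

(** Sum [term_le] over m: one geometric series serves for all n. *)
Lemma recentered_bounded (s : R) : 0 <= s -> nm w + s < t ->
  coef_bounded A s (M / (1 - (nm w + s) / t)).
Proof.
move=> s0 st n; have q01 := q_lt1 s0 st.
rewrite -(subr0 (A n)) -{1}(ger0_norm s0) -(nm_real s) -nmX mulrC -nmM mulrBr mulr0.
apply: ccvg_le (ccvgZ _ (aA n)) _; near=> N.
rewrite subr0 mulr_sumr.
have := @dominated_tail (fun m => Complex s 0 ^+ n * ('C(m, n)%:R * a m * w ^+ (m - n)))
   M _ 0 N q01; rewrite expr0 mul1r; apply => m.
by rewrite nmM nmX nm_real ger0_norm// mulrC term_le.
Unshelve. all: by end_near. Qed.

(** The interchange of the double sum of C(m, n) a_m w^(m-n) h^n is done on truncations n < N, m <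
    K. The square m < N gives exactly the N-th partial sum at w + h by the binomial theorem; the
    strip N <= m < K is bounded by a geometric tail uniformly in K. Let K, then N, tend to
    infinity. *)
Lemma recentered_csum h l : nm w + nm h < t ->
  csum (fun m => a m * (w + h) ^+ m) l -> csum (fun n => A n * h ^+ n) l.
Proof.
move=> wht al; have q01 := q_lt1 (nm_ge0 h) wht.
set q := _ / t in q01.
suff D N : nm (\sum_(0 <= n < N) A n * h ^+ n -
    \sum_(0 <= m < N) a m * (w + h) ^+ m) <= M * (q ^+ N / (1 - q)).
  have := cvgD0 (geometric_tail_cvg M q01) al.
  move=> /ccvg_squeeze; apply => N /=; apply: le_trans (lerD (D N) (lexx _)).
  by apply: le_trans (nmD _ _); rewrite addrA subrK.
pose F n K := h ^+ n * \sum_(0 <= m < K) 'C(m, n)%:R * a m * w ^+ (m - n).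
have Fcvg : ccvg (fun K => \sum_(0 <= n < N) F n K) (\sum_(0 <= n < N) A n * h ^+ n).
  under eq_bigr do rewrite mulrC.
  by apply: ccvg_sum => // n; apply: ccvgZ; exact: aA.
apply: ccvg_le Fcvg _; near=> K.
have NK : (N <= K)%N by near: K; exact: nbhs_infty_ge.
have -> : \sum_(0 <= n < N) F n K = \sum_(0 <= m < K) \sum_(0 <= n < N)
    'C(m, n)%:R * a m * w ^+ (m - n) * h ^+ n.
  rewrite exchange_big/=; apply: eq_bigr => n _.
  by rewrite /F mulr_sumr; apply: eq_bigr => m _; rewrite mulrC.
rewrite (big_cat_nat (n := N))//=.
rewrite (_ : \sum_(0 <= m < N) \sum_(0 <= n < N) _ = \sum_(0 <= m < N) a m * (w + h) ^+ m).
  rewrite [X in nm X]addrC addKr; apply: dominated_tail => // m.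
  apply: le_trans (nm_sum _ _ _) _.
  apply: (@le_trans _ _ (nm (a m) * \sum_(0 <= n < N) 'C(m, n)%:R * nm w ^+ (m - n) *
    nm h ^+ n)).
    rewrite mulr_sumr; apply: ler_sum => n _.
    by rewrite !nmM !nmX nm_nat !mulrA (mulrC (nm (a m))).
  apply: (@le_trans _ _ (nm (a m) * (nm w + nm h) ^+ m)).
    by rewrite ler_wpM2l ?nm_ge0// binomial_sum_le ?nm_ge0.
  rewrite expr_div_n mulrA ler_pdivlMr ?exprn_gt0//.
  by rewrite mulrAC ler_wpM2r// exprn_ge0 ?addr_ge0 ?nm_ge0.
rewrite !big_nat; apply: eq_bigr => m /andP[_ mN].
rewrite (big_cat_nat (n := m.+1))//= [X in _ + X]big_nat [X in _ + X]big1 ?addr0.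
  rewrite exprDn mulr_sumr big_mkord; apply: eq_bigr => i _.
  by rewrite -[X in _ = _ * X]mulr_natl; ring.
by move=> n /andP[mn _]; rewrite bin_small// !mul0r.
Unshelve. all: by end_near. Qed.

End recenter.

End power_series.

(** * Roots of unity and Cauchy's estimate *)

Section roots_of_unity.
Variable R : realType.
Implicit Types (z w : cplx R).

(** X^n - 1 splits and is separable since n is invertible, so it has n distinct roots, which forces
    a primitive one. *)
Lemma prim_root_exists n : (0 < n)%N -> exists w : cplx R, n.-primitive_root w.
Proof.
move=> n0; pose p : {poly cplx R} := 'X^n - 1.
have [r Dp] := closed_field_poly_normal p.
have lc : lead_coef p = 1 by rewrite /p lead_coefXnsubC.
rewrite lc scale1r in Dp.
have /hasP[w _ wp] : has n.-primitive_root r; last by exists w.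
apply: has_prim_root => //.
- by apply/allP => w; rewrite unity_rootE -subr_eq0 -root_prod_XsubC -Dp /root /p !hornerE.
- rewrite -separable_prod_XsubC -Dp; apply: separable_Xn_sub_1.
  by rewrite pnatr_eq0 -lt0n.
- by rewrite -ltnS -(size_prod_XsubC r id) -Dp size_XnsubC.
Qed.

Lemma nm_prim_root n w : n.-primitive_root w -> nm w = 1.
Proof.
move=> wn; have n0 := prim_order_gt0 wn; apply/eqP.
by rewrite -(pexpr_eq1 n0 (nm_ge0 w)) -nmX (prim_expr_order wn) nm1.
Qed.

Lemma nm_sqE z : Complex (nm z ^+ 2) 0 = z * z^* :> cplx R.
Proof. by rewrite -normCK normE expr2 /=; apply/eqP;
  rewrite eq_complex /= !mul0r !mulr0 subr0 addr0 !eqxx. Qed.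

(** Conjugation inverts elements of the unit circle, so this is the geometric sum of x = w^i / w^j,
    where x^n = 1 and, for distinct i, j < n, x is not 1. *)
Lemma prim_root_orthogonal n w i j : n.-primitive_root w -> (i < n)%N -> (j < n)%N ->
  \sum_(0 <= k < n) w ^+ (k * i) * (w ^+ (k * j))^* = (if i == j then n%:R else 0 : cplx R).
Proof.
move=> wn ltin ltjn; have w1 := nm_prim_root wn.
have w0 : w != 0 by rewrite -nm_eq0 w1 oner_eq0.
have wV k : (w ^+ k)^* = (w ^+ k)^-1.
  apply: (@mulfI _ (w ^+ k)); first by rewrite expf_eq0 negb_and w0 orbT.
  by rewrite -nm_sqE nmX w1 !expr1n divff// expf_eq0 negb_and w0 orbT.
under eq_bigr do rewrite wV.
pose x := w ^+ i / w ^+ j.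
have xE k : w ^+ (k * i) / w ^+ (k * j) = x ^+ k.
  by rewrite !(mulnC k) /x expr_div_n -!exprM.
under eq_bigr do rewrite xE.
have wj : w ^+ j != 0 by rewrite expf_eq0 negb_and w0 orbT.
case: eqP => [ij|/eqP ij].
  rewrite (_ : x = 1) ?big_mkord; last by rewrite /x ij divff.
  by under eq_bigr do rewrite expr1n; rewrite sumr_const card_ord.
have x1 : x - 1 != 0.
  rewrite subr_eq0; apply: contra ij => /eqP x1.
  have : w ^+ i == w ^+ j by rewrite -(divfK wj (w ^+ i)) -/x x1 mul1r.
  by rewrite (eq_prim_root_expr wn) !modn_small.
apply: (mulfI x1); rewrite big_mkord -subrX1 mulr0 /x expr_div_n -!exprM.
by rewrite mulnC exprM (mulnC j) exprM (prim_expr_order wn) !expr1n divr1 subrr.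
Qed.

Lemma prim_root_parseval n w (b : nat -> cplx R) : n.-primitive_root w ->
  \sum_(0 <= k < n) nm (\sum_(0 <= i < n) b i * w ^+ (k * i)) ^+ 2 =
  n%:R * \sum_(0 <= i < n) nm (b i) ^+ 2.
Proof.
move=> wn.
(* The real identity is proved after embedding in [cplx R], where squared moduli factor as z times
   its conjugate. *)
have Cinj : injective (fun x : R => Complex x 0 : cplx R) by move=> x y [].
have CM : {morph (fun x : R => Complex x 0 : cplx R) : x y / x * y >-> x * y}.
  by move=> x y; apply/eqP; rewrite eq_complex /= !mul0r !mulr0 subr0 addr0 !eqxx.
have CD : {morph (fun x : R => Complex x 0 : cplx R) : x y / x + y >-> x + y}.
  by move=> x y; apply/eqP; rewrite eq_complex /= addr0 !eqxx.
have Cn : Complex n%:R 0 = n%:R :> cplx R.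
  by elim: n {wn} => // n IH; rewrite -!natr1 CD IH.
apply: Cinj; rewrite CM !(big_morph _ CD (erefl _)) Cn.
transitivity (\sum_(0 <= k < n) \sum_(0 <= i < n) \sum_(0 <= j < n)
   b i * (b j)^* * (w ^+ (k * i) * (w ^+ (k * j))^*)).
  apply: eq_bigr => k _; rewrite nm_sqE rmorph_sum/= mulr_suml.
  apply: eq_bigr => i _; rewrite mulr_sumr; apply: eq_bigr => j _.
  by rewrite rmorphM/=; ring.
rewrite exchange_big/= mulr_sumr big_nat [RHS]big_nat; apply: eq_bigr => i /andP[_ ltin].
rewrite exchange_big/= big_nat.
under eq_bigr => j /andP[_ ltjn] do rewrite -mulr_sumr (prim_root_orthogonal wn ltin ltjn).
rewrite -big_nat (bigD1_seq i)/= ?iota_uniq ?mem_index_iota//= eqxx big1 ?addr0.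
  by rewrite nm_sqE mulrC.
by move=> j /negbTE ji; rewrite eq_sym ji mulr0.
Qed.

End roots_of_unity.

(** * Cauchy's estimate and uniqueness of coefficients *)

Section cauchy.
Variable R : realType.
Implicit Types (a b : nat -> cplx R) (z w h l : cplx R).

(** Average the squared modulus of the N-th partial sum over the N points r w^k. Discrete Parseval
    makes this at least (|a_n| r^n)^2 once N > n, while each partial sum is at most B + [eps N].
    Then N tends to infinity. *)
Lemma cauchy_estimate a (t M B r : R) (F : cplx R -> cplx R) n :
  coef_bounded a t M -> 0 <= r -> r < t ->
  (forall z, nm z = r -> csum (fun n => a n * z ^+ n) (F z)) ->
  (forall z, nm z = r -> nm (F z) <= B) ->
  nm (a n) * r ^+ n <= B.
Proof.
move=> aM r0 rt aF FB; have t0 : 0 < t by apply: le_lt_trans rt.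
have q01 : 0 <= r / t < 1.
  by rewrite divr_ge0 ?(ltW t0)//= ltr_pdivrMr// mul1r.
have B0 : 0 <= B by apply: le_trans (nm_ge0 _) (FB (Complex r 0) _);
  rewrite nm_real ger0_norm.
have M0 : 0 <= M by apply: le_trans (aM 0%N); rewrite mulr_ge0 ?nm_ge0// expr0.
pose eps N : R := M * ((r / t) ^+ N / (1 - r / t)).
have eps0 N : 0 <= eps N.
  case/andP: q01 => q0 q1.
  by rewrite mulr_ge0// divr_ge0 ?exprn_ge0// subr_ge0 ltW.
have bound N : (n < N)%N -> nm (a n) * r ^+ n <= B + eps N.
  move=> nN; have N0 : (0 < N)%N by apply: leq_ltn_trans nN.
  have [w wN] := prim_root_exists R N0.
  have w1 := nm_prim_root wN.
  have lhs0 : 0 <= nm (a n) * r ^+ n by rewrite mulr_ge0 ?exprn_ge0 ?nm_ge0.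
  have rhs0 : 0 <= B + eps N by exact: addr_ge0.
  rewrite -(ler_pXn2r (n := 2)) ?nnegrE//.
  have N0R : 0 < N%:R :> R by rewrite ltr0n.
  rewrite -(ler_pM2l N0R).
  pose b i := a i * (Complex r 0) ^+ i.
  have nb i : nm (b i) = nm (a i) * r ^+ i.
    by rewrite nmM nmX nm_real ger0_norm.
  apply: (@le_trans _ _ (N%:R * \sum_(0 <= i < N) nm (b i) ^+ 2)).
    rewrite ler_wpM2l// -nb (bigD1_seq n)/= ?iota_uniq ?mem_index_iota//=.
    by rewrite lerDl sumr_ge0// => i _; rewrite sqr_ge0.
  rewrite -(prim_root_parseval b wN).
  have -> : N%:R * (B + eps N) ^+ 2 = \sum_(0 <= k < N) (B + eps N) ^+ 2.
    by rewrite sumr_const_nat subn0 mulr_natl.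
  apply: ler_sum => k _.
  rewrite lerXn2r ?nnegrE ?nm_ge0//.
  have zr : nm (w ^+ k * Complex r 0) = r by rewrite nmM nmX w1 expr1n mul1r nm_real
    ger0_norm.
  rewrite (_ : \sum_(0 <= i < N) _ =
    \sum_(0 <= i < N) a i * (w ^+ k * Complex r 0) ^+ i); last first.
    by apply: eq_bigr => i _; rewrite /b exprMn exprM -mulrA (mulrC (_ ^+ i)).
  set z := w ^+ k * _ in zr *.
  have dom m : nm (a m * z ^+ m) <= M * (r / t) ^+ m.
    by rewrite -zr; exact: coef_bounded_term.
  have := csum_tail N q01 dom (aF _ zr); rewrite -/(eps N) => h1.
  apply: le_trans (lerD (FB _ zr) h1); rewrite -[X in _ + X]nmN.
  by apply: le_trans (nmD _ _); rewrite opprB addrC subrK.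
apply/ler_addgt0Pr => e e0.
have /cvgr0Pnorm_lt/(_ _ e0)[K _ epsN] := geometric_tail_cvg M q01.
have /= := epsN (maxn K n.+1) (leq_maxl _ _).
rewrite ger0_norm ?eps0// => /ltW eN.
by apply: le_trans (bound (maxn K n.+1) (leq_maxr _ _)) _; rewrite lerD2l.
Qed.

(** Cauchy's estimate with bound 0 for the difference of the two series, on the circle of radius t /
    4; convergence at t / 2 supplies the coefficient bound it requires. *)
Lemma power_series_unique a b (t : R) : 0 < t ->
  (forall z, nm z < t -> exists2 l, csum (fun n => a n * z ^+ n) l &
                                    csum (fun n => b n * z ^+ n) l) ->
  a =1 b.
Proof.
move=> t0 ab n.
pose c n := a n - b n.
have c0 z : nm z < t -> csum (fun n => c n * z ^+ n) 0.
  move=> /ab[l al bl]; have := csumD al (csumZ (-1) bl).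
  rewrite mulN1r subrr (_ : _ \+ _ = fun n => c n * z ^+ n)//.
  by apply/funext => m /=; rewrite mulN1r -mulrBl.
have t2 : 0 < t / 2 by rewrite divr_gt0.
have t4 : 0 < t / 4 by rewrite divr_gt0.
have nt2 : nm (Complex (t / 2) 0) = t / 2 by rewrite nm_real gtr0_norm.
have [|M cM] := csum_coef_bounded (c0 (Complex (t / 2) 0) _).
  by rewrite nt2; lra.
rewrite nt2 in cM.
have := @cauchy_estimate c (t / 2) M 0 (t / 4) (fun=> 0) n cM (ltW t4).
have -> : t / 4 < t / 2 by lra.
move=> /(_ isT) cn; apply/eqP; rewrite -subr_eq0 -nm_eq0 eq_le nm_ge0 andbT.
rewrite -(pmulr_lle0 _ (exprn_gt0 n t4)); apply: cn => z zt; last by rewrite nm0.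
by apply: c0; rewrite zt; lra.
Qed.

End cauchy.

(** * Global power series on the disk *)

Section expansion.
Variable R : realType.
Implicit Types (f : cplx R -> cplx R) (a b : nat -> cplx R) (z w h l : cplx R).

(** Radius and coefficient bound are explicit so that compactness can make both independent of the
    centre. *)
Definition expansion_at f w (d M : R) :=
  exists2 b, coef_bounded b d M &
    forall h, nm h < d -> csum (fun n => b n * h ^+ n) (f (w + h)).

Lemma expansion_at_le f w (d d' M M' : R) : 0 <= d' -> d' <= d -> M <= M' ->
  expansion_at f w d M -> expansion_at f w d' M'.
Proof.
move=> d0 dd MM [b bM bf]; exists b; first exact: coef_bounded_le MM bM.
by move=> h hd; apply: bf; exact: lt_le_trans hd dd.
Qed.

Lemma analytic_expansion f z : analytic_at f z ->
  exists d M, 0 < d /\ expansion_at f z d M.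
Proof.
move=> [a /nbhs_ballP[e /= e0 ea]].
pose r := complex.Re e.
have eE : e = Complex r 0.
  by move: e0; rewrite ltcE /= => /andP[/eqP]; rewrite /r; case: (e) => ? ? /= ->.
have r0 : 0 < r by move: e0; rewrite ltcE /= => /andP[].
have conv h : nm h < r -> csum (fun n => a n * h ^+ n) (f (z + h)).
  move=> hr; apply/ccvgP; have := ea (z + h); rewrite /= addrAC subrr add0r; apply.
  by rewrite -ball_normE /= opprD addrA subrr add0r normrN eE norm_lt_nm.
have nr2 : nm (Complex (r / 2) 0) = r / 2 by rewrite nm_real gtr0_norm ?divr_gt0.
have [|M aM] := csum_coef_bounded (conv (Complex (r / 2) 0) _).
  by rewrite nr2; lra.
exists (r / 2), M; split; first by rewrite divr_gt0.
by exists a; [rewrite -nr2 | move=> h hr; apply: conv; lra].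
Qed.

Lemma expansion_shift f z (d M : R) h : 0 < d -> expansion_at f z d M ->
  nm h < d / 4 -> expansion_at f (z + h) (d / 8) (2 * M).
Proof.
move=> d0 [a aM af] hd; have hd1 : nm h < d by lra.
have [A aA] := recentered_exists d0 aM hd1.
have M0 : 0 <= M by apply: le_trans (aM 0%N); rewrite mulr_ge0 ?nm_ge0// expr0.
exists A.
  have hs : nm h + d / 8 < d by lra.
  apply: coef_bounded_le (recentered_bounded d0 aM aA _ hs) => //;
    try by rewrite divr_ge0// ltW.
  (* The ratio is below 1/4 + 1/8, so the bound M / (1 - ratio) is at most 2 M. *)
  have q2 : (nm h + d / 8) / d <= 2^-1 by rewrite ler_pdivrMr//; lra.
  rewrite ler_pdivrMr; last by lra.
  by nra.
move=> k kd; have hkd : nm h + nm k < d by lra.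
rewrite -addrA; apply: (recentered_csum d0 aM aA hkd).
by apply: af; apply: le_lt_trans (nmD _ _) hkd.
Qed.

Lemma uniform_expansion f (r : R) : analytic_on_disk f -> r < 1 ->
  exists n : nat, forall w, nm w <= r -> expansion_at f w n.+1%:R^-1 n%:R.
Proof.
move=> fan r1.
(* A single integer governs radius and bound, and the condition weakens as it grows, as the covering
   argument requires. The premise makes it vacuous outside the closed disk, so a square can serve as
   the compact set. *)
pose P n (p : R * R) := nm (cplx_of p) <= r -> expansion_at f (cplx_of p) n.+1%:R^-1 n%:R.
have K : compact (`[-1, 1]%classic `*` `[-1, 1]%classic : set (R * R)).
  by apply: compact_setX; exact: segment_compact.
have close (p0 p : R * R) (e : R) : ball p0.1 (e / 2) p.1 -> ball p0.2 (e / 2) p.2 ->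
    nm (cplx_of p - cplx_of p0) < e.
  rewrite /ball/= => h1 h2; apply: le_lt_trans (nm_le_ReIm _) _; rewrite /=.
  rewrite distrC (distrC p.2); lra.
have near_close (p0 : R * R) (e : R) : 0 < e -> \forall p \near p0, nm (cplx_of p -
  cplx_of p0) < e.
  move=> e0; have e2 : 0 < e / 2 by rewrite divr_gt0.
  exists (ball p0.1 (e / 2), ball p0.2 (e / 2)); first by split; exact: nbhsx_ballx.
  by move=> p [/= h1 h2]; exact: close.
have [n _ /(_ n (leqnn n)) nP] : \forall n \near \oo, forall p : R * R,
    (`[-1, 1]%classic `*` `[-1, 1]%classic) p -> P n p.
  apply: (iffLR (compact_near_coveringP _) K) => p0 _.
  have [p1|p1] := ltP (nm (cplx_of p0)) 1; last first.
    (* Around a centre of modulus at least 1, all points closer than 1 - r have modulus above r,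
       where [P] is vacuous. *)
    have e0 : 0 < 1 - r by rewrite subr_gt0.
    have := near_close p0 _ e0 => -[[U V] UV /= H].
    exists (U `*` V, setT); first by split => //=; [exists (U, V) | exact: filterT].
    move=> [p n] [/= /H pe _]; rewrite /P/= => pr.
    have : nm (cplx_of p0) <= nm (cplx_of p) + nm (cplx_of p - cplx_of p0).
      rewrite -(nmN (_ - _)) opprB; apply: le_trans (nmD _ _).
      by rewrite addrC subrK.
    by lra.
  have p0D : unit_disk (cplx_of p0) by rewrite unit_diskE.
  have [d [M [d0 fd]]] := analytic_expansion (fan _ p0D).
  have d4 : 0 < d / 4 by rewrite divr_gt0.
  have [[U V] UV /= H] := near_close p0 _ d4.
  (* The first summand makes 1/(n+1) at most d / 8, the second makes n at least 2 M. *)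
  pose N := (Num.truncn (8 / d) + Num.truncn (2 * M)).+1.
  exists (U `*` V, [set n | (N <= n)%N]).
    by split => //=; [exists (U, V) | exists N].
  move=> [p n] [/= /H pd Nn] _ /=.
  rewrite -(subrK (cplx_of p0) (cplx_of p)) addrC.
  have big (x : R) m : (Num.truncn x < m)%N -> x <= m%:R.
    move=> xm; apply: le_trans (ltW (truncnS_gt x)) _.
    by rewrite ler_nat.
  apply: expansion_at_le (expansion_shift d0 fd pd).
  - by rewrite invr_ge0.
  - rewrite -[leRHS]invrK lef_pV2 ?posrE ?invr_gt0 ?divr_gt0// invf_div.
    by apply: big; rewrite ltnS; apply: leq_trans Nn; rewrite /N ltnW// ltnS leq_addr.
  - by apply: big; apply: leq_trans Nn; rewrite /N ltnS leq_addl.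
exists n => w wr.
have -> : w = cplx_of (complex.Re w, complex.Im w) by case: (w).
apply: nP; last by case: (w) wr.
split => /=; rewrite in_itv /= -ler_norml.
  by apply: le_trans (Re_le_nm w) _; lra.
by apply: le_trans (Im_le_nm w) _; lra.
Qed.

(** By uniqueness on a small common disk, the local coefficients b are the recentered a. The second
    conclusion then reaches all h with |w| + |h| < t, including points where f is not yet known to
    be the sum of a: this is the continuation step. *)
Lemma expansion_recentered f a b w (t M d e : R) :
  0 < t -> coef_bounded a t M -> nm w < t -> 0 < d -> 0 < e ->
  (forall h, nm h < e -> csum (fun n => a n * (w + h) ^+ n) (f (w + h))) ->
  (forall h, nm h < d -> csum (fun n => b n * h ^+ n) (f (w + h))) ->
  (forall n, recentered a w n (b n)) /\
  (forall h l, nm w + nm h < t -> csum (fun n => a n * (w + h) ^+ n) l ->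
     csum (fun n => b n * h ^+ n) l).
Proof.
move=> t0 aM wt d0 e0 af bf; have [A aA] := recentered_exists t0 aM wt.
pose s := Num.min (t - nm w) (Num.min d e).
have s0 : 0 < s by rewrite !lt_min subr_gt0 wt d0 e0.
have Ab : A = b.
  apply/funext; apply: (power_series_unique s0) => h; rewrite !lt_min => /and3P[hw hd he].
  exists (f (w + h)); last exact: bf.
  by apply: (recentered_csum t0 aM aA); [lra | exact: af].
by rewrite -Ab; split => // h l; exact: recentered_csum.
Qed.

Definition sums_to f a (t : R) :=
  forall w, nm w < t -> csum (fun n => a n * w ^+ n) (f w).

Lemma sums_to_bounded f a (t r : R) : sums_to f a t -> 0 <= r -> r < t ->
  exists M, coef_bounded a r M.
Proof.
move=> af r0 rt; have nr : nm (Complex r 0) = r by rewrite nm_real ger0_norm.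
have [|M] := csum_coef_bounded (af (Complex r 0) _); first by rewrite nr.
by rewrite nr; exists M.
Qed.

(* Cauchy's estimate, applied to the n-th Taylor coefficient at w as a power
   series in w, bounds C(m, n) |a_m| r^(m - n) d^n; summing over n against
   2^-n yields the binomial (r + d / 2)^m. *)
Lemma sums_to_extend_bounded f a (t d M : R) : sums_to f a t -> 0 < d ->
  (forall w, nm w < t -> expansion_at f w d M) ->
  forall r, 0 <= r -> r < t -> coef_bounded a (r + d / 2) (2 * M).
Proof.
move=> af d0 fd r r0 rt m.
have taylor n w : nm w < t -> exists2 b, recentered a w n b & nm b * d ^+ n <= M.
  move=> wt; have [b bM bf] := fd _ wt.
  have t0 : 0 < (nm w + t) / 2 by have := nm_ge0 w; lra.
  have wt2 : nm w < (nm w + t) / 2 by lra.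
  have [|N aN] := sums_to_bounded af (ltW t0); first by lra.
  have e0 : 0 < t - nm w by lra.
  have near h : nm h < t - nm w -> csum (fun n => a n * (w + h) ^+ n) (f (w + h)).
    by move=> ht; apply: af; apply: le_lt_trans (nmD w h) _; lra.
  have [ab _] := expansion_recentered t0 aN wt2 d0 e0 near bf.
  by exists (b n).
have dn n : 0 < d ^+ n by rewrite exprn_gt0.
have coef n k : 'C(n + k, n)%:R * nm (a (n + k)%N) * r ^+ k * d ^+ n <= M.
  have [F Fn] : exists F : cplx R -> cplx R, forall w, nm w < t ->
      recentered a w n (F w) /\ nm (F w) * d ^+ n <= M.
    suff /choice[F HF] : forall w, exists l, nm w < t -> recentered a w n l /\ nm l * d
      ^+ n <= M.
      by exists F.
    move=> w; have [wt|tw] := ltP (nm w) t; last by exists 0.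
    by have [b ab bM] := taylor n w wt; exists b.
  (* The n-th Taylor coefficient as a power series in the centre; the first n terms of the
     recentering sum vanish, hence the shift. *)
  pose c k := 'C(n + k, n)%:R * a (n + k)%N.
  have cF w : nm w < t -> csum (fun k => c k * w ^+ k) (F w).
    move=> /Fn[FM _]; apply/ccvgP; move/ccvgP : FM.
    rewrite -(cvg_shiftn n) (_ : (fun _ => _) = (fun N => \sum_(0 <= k < N) c k * w ^+
      k))//.
    apply/funext => N /=; rewrite (big_cat_nat (n := n)) ?leq_addl//=.
    rewrite [X in X + _]big_nat [X in X + _]big1 ?add0r; last first.
      by move=> i /andP[_ ni]; rewrite bin_small// !mul0r.
    rewrite -{1}(add0n n) big_addn addnK; apply: eq_bigr => i _.
    by rewrite /c addnK (addnC i).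
  have s0 : 0 <= (r + t) / 2 by lra.
  have rs : r < (r + t) / 2 by lra.
  have [|K cK] := sums_to_bounded cF s0; first by lra.
  have := @cauchy_estimate R c ((r + t) / 2) K (M / d ^+ n) r F k cK r0 rs.
  rewrite ler_pdivlMr// /c nmM nm_nat; apply => w wr.
    by apply: cF; rewrite wr.
  by rewrite ler_pdivlMr//; have [] : recentered a w n (F w) /\ nm (F w) * d ^+ n <= M
    by apply: Fn; rewrite wr.
have M0 : 0 <= M.
  by apply: le_trans (coef 0%N 0%N); rewrite !mulr_ge0 ?nm_ge0// expr0.
rewrite exprDn mulr_sumr.
apply: (@le_trans _ _ (\sum_(i < m.+1) M * 2^-1 ^+ i)).
  apply: ler_sum => i _; have im : (i <= m)%N by rewrite -ltnS.
  have := coef i (m - i)%N; rewrite subnKC// => h.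
  rewrite (_ : _ * _ = 'C(m, i)%:R * nm (a m) * r ^+ (m - i) * d ^+ i * 2^-1 ^+ i).
    by rewrite ler_wpM2r// exprn_ge0// invr_ge0.
  by rewrite exprMn -[X in _ * X = _]mulr_natl; ring.
rewrite -mulr_sumr mulrC ler_wpM2r//.
rewrite -(big_mkord xpredT (fun i => 2^-1 ^+ i)).
have h2 : 0 <= (2^-1 : R) < 1 by apply/andP; split; lra.
have := geometric_tail 0 m.+1 h2; rewrite expr0 (_ : 1 / (1 - 2^-1) = 2)//.
by field.
Qed.

Lemma disk_power_series f : analytic_on_disk f -> exists a, sums_to f a 1.
Proof.
move=> fan; have D0 : unit_disk (0 : cplx R) by rewrite unit_diskE nm0.
have [d0 [M0 [d00 [a aM0 af0]]]] := analytic_expansion (fan _ D0).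
exists a; pose S := [set t : R | t <= 1 /\ sums_to f a t].
pose d1 := Num.min d0 1.
have Sd1 : S d1.
  split; first by rewrite ge_min lexx orbT.
  by move=> w; rewrite lt_min => /andP[wd _]; have := af0 w wd; rewrite add0r.
have hS : has_sup S by split; [exists d1 | exists 1 => t []].
pose rho := sup S.
have rho0 : 0 < rho.
  apply: lt_le_trans (sup_upper_bound hS Sd1).
  by rewrite lt_min d00 ltr01.
(* The disks are open, so the supremum is attained: |w| < rho lies below some admissible radius. *)
have af : sums_to f a rho.
  move=> w wrho; have e0 : 0 < rho - nm w by rewrite subr_gt0.
  have [t [_ at_]] := sup_adherent e0 hS.
  by rewrite -/rho subKr => /at_.
have rho1 : rho <= 1 by apply: ge_sup => [|t []]//; exists d1.
have [rho_lt|] := ltP rho 1; last by move=> h w w1; apply: af; exact: lt_le_trans h.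
exfalso.
have [n fn] := uniform_expansion fan rho_lt.
set d : R := n.+1%:R^-1 in fn; have dp : 0 < d by rewrite invr_gt0.
have ab := sums_to_extend_bounded af dp (fun w wr => fn w (ltW wr)).
(* This gives r + d / 2 >= rho + d / 4, so the coefficient bound passes beyond rho; the maximum with
   0 covers rho < d / 4. *)
pose r := Num.max 0 (rho - d / 4).
have r0 : 0 <= r by rewrite le_max lexx.
have rr : r < rho by rewrite gt_max rho0/=; lra.
have rr' : rho - d / 4 <= r by rewrite le_max lexx orbT.
pose t := r + d / 2.
have t0 : 0 < t by rewrite /t; lra.
have tM : coef_bounded a t (2 * n%:R) := ab r r0 rr.
suff St : S (Num.min t 1).
  have := sup_upper_bound hS St; rewrite -/rho leNgt => /negP; apply.
  by rewrite lt_min rho_lt andbT /t; lra.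
split; first by rewrite ge_min lexx orbT.
move=> w; rewrite lt_min => /andP[wt w1].
have [wrho|rhow] := ltP (nm w) rho; first exact: af.
have w0 : 0 < nm w by apply: lt_le_trans rhow.
(* c w is the radial projection of w onto the circle of radius r, where f is already the sum of a;
   its distance to w is |w| - r < d / 2. *)
pose c : cplx R := Complex (r / nm w) 0.
have nc : nm c = r / nm w by rewrite nm_real ger0_norm// divr_ge0// ltW.
have n0 : nm (c * w) = r by rewrite nmM nc divfK// gt_eqF.
have nh : nm (w - c * w) = nm w - r.
  rewrite -{1}(mul1r w) -mulrBl nmM.
  rewrite (_ : 1 - c = Complex (1 - r / nm w) 0); last first.
    by apply/eqP; rewrite eq_complex /= subr0 !eqxx.
  rewrite nm_real ger0_norm; last by rewrite subr_ge0 ler_pdivrMr// mul1r; lra.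
  by rewrite mulrBl mul1r divfK// gt_eqF.
have cwrho : nm (c * w) <= rho by rewrite n0 ltW.
have [b bM bf] := fn _ cwrho.
have cwt : nm (c * w) < t by rewrite n0 /t; lra.
have e0 : 0 < rho - r by rewrite subr_gt0.
have near h : nm h < rho - r -> csum (fun n => a n * (c * w + h) ^+ n) (f (c * w + h)).
  move=> hr; apply: af; apply: le_lt_trans (nmD _ _) _.
  by rewrite n0; lra.
have [_ ba] := expansion_recentered t0 tM cwt dp e0 near bf.
have [l al] := coef_bounded_csum t0 tM wt.
(* The expansion at c w evaluated at w converges to the sum l of a at w, and also to f w. *)
have bl : csum (fun n => b n * (w - c * w) ^+ n) l.
  by apply: ba; rewrite ?n0 ?nh subrKC.
have := bf (w - c * w); rewrite nh subrKC => bfw.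
rewrite (ccvg_unique (bfw _) bl)//.
by move: wt; rewrite /t; lra.
Qed.

Lemma sums_to_analytic f a : sums_to f a 1 -> analytic_on_disk f.
Proof.
move=> af z; rewrite unit_diskE => z1.
pose t := (nm z + 1) / 2; have t0 : 0 < t by rewrite /t; have := nm_ge0 z; lra.
have zt : nm z < t by rewrite /t; lra.
have [|M aM] := sums_to_bounded af (ltW t0); first by rewrite /t; lra.
have [A aA] := recentered_exists t0 aM zt.
exists A; apply/nbhs_ballP; exists (Complex (t - nm z) 0).
  by rewrite /= ltcE /= eqxx /= subr_gt0.
move=> w; rewrite -ball_normE /= norm_lt_nm -nmN opprB => wz.
apply/ccvgP; have wt : nm z + nm (w - z) < t by lra.
apply: (recentered_csum t0 aM aA wt); rewrite subrKC; apply: af.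
rewrite -(subrK z w); apply: le_lt_trans (nmD _ _) _.
by move: wt; rewrite /t; lra.
Qed.

End expansion.

(** * Affine changes of variables in the plane *)

Section plane.
Variable R : realType.
Local Notation leb := (@lebesgue_measure R).
Local Notation leb2 := (leb \x leb)%E.

(** Lebesgue measure and r times its image under x -> r x + t agree on half-open intervals, hence
    are equal. *)
Lemma integral_affine (G : R -> \bar R) (r t : R) : 0 < r ->
  measurable_fun setT G -> (forall x, 0 <= G x)%E ->
  (\int[leb]_x G (r * x + t)%R = r^-1%:E * \int[leb]_x G x)%E.
Proof.
move=> r0 mG G0; pose phi (x : measurableTypeR R) : measurableTypeR R := (r * x + t)%R.
have mphi : measurable_fun setT phi.
  by apply: measurable_funD => //; apply: measurable_funM.
have := @ge0_integral_pushforward _ _ _ _ _ phi mphi leb setT G measurableT mG.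
rewrite preimage_setT /= => <-; last by move=> y _; exact: G0.
have rN : (0 <= r)%R := ltW r0.
have E A : measurable A -> leb A = mscale (NngNum rN) (pushforward leb phi) A.
  apply: lebesgue_measure_unique => //= _ [[a b]] _ <-.
  rewrite /mscale /= /pushforward.
  have -> : phi @^-1` `]a, b] = `](a - t) / r, (b - t) / r]%classic.
    apply/seteqP; split => x /=; rewrite !in_itv/= /phi.
      by rewrite ltr_pdivrMr// ler_pdivlMr// ltrBlDr lerBrDr mulrC.
    by rewrite ltr_pdivrMr// ler_pdivlMr// ltrBlDr lerBrDr mulrC.
  rewrite !lebesgue_measure_itv/= !lte_fin ltr_pM2r ?invr_gt0// ltrD2r.
  case: ifP => _; last by rewrite mule0.
  rewrite -!EFinB -mulrBl opprD addrACA subrr addr0 -EFinM.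
  by rewrite mulrCA mulfV ?mulr1// gt_eqF.
rewrite (eq_measure_integral (mscale (NngNum rN) (pushforward leb phi)) (m1 := leb));
  last first.
  by move=> A mA _; exact: E.
rewrite ge0_integral_mscale//= muleA -EFinM mulVf ?mul1e// gt_eqF//.
Qed.

(** Tonelli with x innermost: for fixed y this is the one-variable substitution with translation t
    y. It covers shears (r = 1) and dilations of one coordinate (t = 0). *)
Lemma integral_plane_affine1 (G : R * R -> \bar R) (r t : R) : 0 < r ->
  measurable_fun setT G -> (forall p, 0 <= G p)%E ->
  (\int[leb2]_p G (r * p.1 + t * p.2, p.2)%R = r^-1%:E * \int[leb2]_p G p)%E.
Proof.
move=> r0 mG G0.
have mH : measurable_fun setT (fun p : R * R => (r * p.1 + t * p.2, p.2)%R).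
  apply/measurable_fun_pair => //.
  by apply: measurable_funD; apply: measurable_funM.
rewrite fubini_tonelli2//; last exact: (measurableT_comp mG mH).
rewrite [in RHS]fubini_tonelli2//.
rewrite -ge0_integralZl//; last 3 first.
- exact: measurable_fun_fubini_tonelli_G.
- by move=> y _; apply: integral_ge0.
- by rewrite lee_fin invr_ge0 ltW.
apply: eq_integral => y _ /=; rewrite /fubini_G /=.
apply: (@integral_affine (fun x => G (x, y)) r (t * y)) => //.
exact: measurableT_comp.
Qed.

Lemma integral_plane_affine2 (G : R * R -> \bar R) (r t : R) : 0 < r ->
  measurable_fun setT G -> (forall p, 0 <= G p)%E ->
  (\int[leb2]_p G (p.1, t * p.1 + r * p.2)%R = r^-1%:E * \int[leb2]_p G p)%E.
Proof.
move=> r0 mG G0.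
have mH : measurable_fun setT (fun p : R * R => (p.1, t * p.1 + r * p.2)%R).
  apply/measurable_fun_pair => //.
  by apply: measurable_funD; apply: measurable_funM.
rewrite fubini_tonelli1//; last exact: (measurableT_comp mG mH).
rewrite [in RHS]fubini_tonelli1//.
rewrite -ge0_integralZl//; last 3 first.
- exact: measurable_fun_fubini_tonelli_F.
- by move=> y _; apply: integral_ge0.
- by rewrite lee_fin invr_ge0 ltW.
apply: eq_integral => x _ /=; rewrite /fubini_F /=.
under eq_integral do rewrite addrC.
apply: (@integral_affine (fun y => G (x, y)) r (t * x)) => //.
exact: measurableT_comp.
Qed.

End plane.

(** * Rotations and dilations *)

Section plane_integral.
Variable R : realType.
Local Notation leb2 := (@lebesgue_measure R \x @lebesgue_measure R)%E.
Implicit Types (h k : cplx R -> R) (q : cplx R -> cplx R).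

Definition planar_measurable h := measurable_fun setT (fun p : R * R => h (cplx_of p)).

Definition planar_integral h := (\int[leb2]_p (h (cplx_of p))%:E)%E.

Definition cplx_measurable q :=
  planar_measurable (fun z => complex.Re (q z)) /\
  planar_measurable (fun z => complex.Im (q z)).

Lemma cplx_measurable_id : cplx_measurable id.
Proof. split; [exact: measurable_fst | exact: measurable_snd]. Qed.

Lemma cplx_measurable_cst (c : cplx R) : cplx_measurable (fun=> c).
Proof. by split; exact: measurable_cst. Qed.

Lemma cplx_measurableD q q' : cplx_measurable q -> cplx_measurable q' ->
  cplx_measurable (fun z => q z + q' z).
Proof.
move=> [qR qI] [q'R q'I]; split; rewrite /planar_measurable.
  by under eq_fun do rewrite raddfD; exact: measurable_funD.
by under eq_fun do rewrite raddfD; exact: measurable_funD.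
Qed.

Lemma cplx_measurableM q q' : cplx_measurable q -> cplx_measurable q' ->
  cplx_measurable (fun z => q z * q' z).
Proof.
have mulE (x y : cplx R) : x * y = Complex (complex.Re x * complex.Re y - complex.Im x
  * complex.Im y)
    (complex.Re x * complex.Im y + complex.Im x * complex.Re y).
  by case: x => a b; case: y => c d; apply/eqP; rewrite eq_complex /= !eqxx.
move=> [qR qI] [q'R q'I]; split; rewrite /planar_measurable.
  under eq_fun do rewrite mulE /=.
  by apply: measurable_funB; exact: measurable_funM.
under eq_fun do rewrite mulE /=.
by apply: measurable_funD; exact: measurable_funM.
Qed.

Lemma cplx_measurable_poly (a : nat -> cplx R) N :
  cplx_measurable (fun z => \sum_(0 <= n < N) a n * z ^+ n).
Proof.
have X n : cplx_measurable (fun z => z ^+ n).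
  elim: n => [|n IH]; first exact: cplx_measurable_cst.
  rewrite (_ : (fun _ => _) = fun z : cplx R => z * z ^+ n); last first.
    by apply/funext => z; rewrite exprS.
  by apply: cplx_measurableM => //; exact: cplx_measurable_id.
elim: N => [|N IH].
  rewrite (_ : (fun _ => _) = fun=> 0); first exact: cplx_measurable_cst.
  by apply/funext => z; rewrite big_geq.
rewrite (_ : (fun _ => _) =
  fun z => \sum_(0 <= n < N) a n * z ^+ n + a N * z ^+ N); last first.
  by apply/funext => z; rewrite big_nat_recr.
apply: cplx_measurableD => //; apply: cplx_measurableM => //.
exact: cplx_measurable_cst.
Qed.

Lemma planar_measurable_sq q : cplx_measurable q -> planar_measurable (fun z => nm (q
  z) ^+ 2).
Proof.
move=> [qR qI]; rewrite /planar_measurable.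
under eq_fun do rewrite nm_sq.
by apply: measurable_funD; exact: measurable_funX.
Qed.

Lemma planar_measurable_nm n : planar_measurable (fun z => nm z ^+ (2 * n)).
Proof.
rewrite /planar_measurable; under eq_fun do rewrite exprM.
by apply: measurable_funX; apply: planar_measurable_sq cplx_measurable_id.
Qed.

Lemma planar_measurableM h k : planar_measurable h -> planar_measurable k ->
  planar_measurable (fun z => h z * k z).
Proof. by move=> mh mk; exact: measurable_funM. Qed.

Lemma planar_measurable_disk h (r : R) : 0 <= r -> planar_measurable h ->
  planar_measurable (fun z => if nm z < r then h z else 0).
Proof.
move=> r0 mh; rewrite /planar_measurable.
(* Squaring the comparison replaces the square root in [nm] by a polynomial. *)
rewrite (_ : (fun _ => _) = fun p : R * R =>
  if nm (cplx_of p) ^+ 2 < r ^+ 2 then h (cplx_of p) else 0); last first.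
  by apply/funext => p; rewrite ltr_pXn2r ?nnegrE ?nm_ge0.
apply: measurable_fun_if => //.
- apply: measurable_fun_ltr => //.
  exact: planar_measurable_sq cplx_measurable_id.
- exact: measurable_funS mh.
Qed.

Lemma planar_measurable_comp h q : planar_measurable h -> cplx_measurable q ->
  planar_measurable (h \o q).
Proof.
move=> mh [qR qI]; rewrite /planar_measurable.
rewrite (_ : (fun _ => _) = (fun p : R * R => h (cplx_of p)) \o
   (fun p : R * R => (complex.Re (q (cplx_of p)), complex.Im (q (cplx_of p))))).
  by apply: measurableT_comp => //; exact/measurable_fun_pair.
by apply/funext => p /=; congr h; case: (q _).
Qed.

Lemma planar_integralD h k : planar_measurable h -> planar_measurable k ->
  (forall z, 0 <= h z) -> (forall z, 0 <= k z) ->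
  planar_integral (fun z => h z + k z) = (planar_integral h + planar_integral k)%E.
Proof.
move=> mh mk h0 k0; rewrite /planar_integral.
under eq_integral do rewrite EFinD.
rewrite ge0_integralD//.
- by move=> p _; rewrite lee_fin.
- exact/measurable_EFinP.
- by move=> p _; rewrite lee_fin.
- exact/measurable_EFinP.
Qed.

Lemma planar_integralZ h (c : R) : planar_measurable h ->
  (forall z, 0 <= h z) -> 0 <= c ->
  planar_integral (fun z => c * h z) = (c%:E * planar_integral h)%E.
Proof.
move=> mh h0 c0; rewrite /planar_integral.
under eq_integral do rewrite EFinM.
rewrite ge0_integralZl//; first exact/measurable_EFinP.
by move=> p _; rewrite lee_fin.
Qed.

Lemma planar_integral_le h k : planar_measurable h -> planar_measurable k ->
  (forall z, 0 <= h z) -> (forall z, h z <= k z) ->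
  (planar_integral h <= planar_integral k)%E.
Proof.
move=> mh mk h0 hk; rewrite /planar_integral; apply: ge0_le_integral => //.
- by move=> p _; rewrite lee_fin.
- exact/measurable_EFinP.
- exact/measurable_EFinP.
- by move=> p _; rewrite lee_fin.
Qed.

Lemma planar_integral_ge0 h : (forall z, 0 <= h z) -> (0 <= planar_integral h)%E.
Proof. by move=> h0; apply: integral_ge0 => p _; rewrite lee_fin. Qed.

Lemma planar_integral_sum (I : Type) (r : seq I) (H : I -> cplx R -> R) :
  (forall i, planar_measurable (H i)) -> (forall i z, 0 <= H i z) ->
  planar_integral (fun z => \sum_(i <- r) H i z) = (\sum_(i <- r) planar_integral (H i))%E.
Proof.
move=> mH H0; elim: r => [|i r IH].
  rewrite big_nil /planar_integral; under eq_integral do rewrite big_nil.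
  by rewrite integral0.
rewrite big_cons -IH -planar_integralD//.
- by congr planar_integral; apply/funext => z; rewrite big_cons.
- elim: r {IH} => [|j r IH].
    rewrite /planar_measurable; under eq_fun do rewrite big_nil.
    exact: measurable_cst.
  rewrite /planar_measurable; under eq_fun do rewrite big_cons.
  exact: (measurable_funD (mH j) IH).
- by move=> z; exact: sumr_ge0.
Qed.

Lemma planar_integral_dilation h (r : R) : 0 < r -> planar_measurable h ->
  (forall z, 0 <= h z) ->
  planar_integral (fun z => h (Complex r 0 * z)) = ((r ^- 2)%:E * planar_integral h)%E.
Proof.
move=> r0 mh h0; pose G (p : R * R) := (h (cplx_of p))%:E.
have mG : measurable_fun setT G by exact/measurable_EFinP.
have G0 p : (0 <= G p)%E by rewrite lee_fin.
have mG' : measurable_fun setT (fun p : R * R => G (p.1, 0 * p.1 + r * p.2)).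
  apply: (measurableT_comp mG); apply/measurable_fun_pair => //.
  by apply: measurable_funD; apply: measurable_funM.
have := integral_plane_affine1 0 r0 mG' (fun p => G0 _).
rewrite (integral_plane_affine2 0 r0 mG G0) muleA -EFinM -expr2 exprVn => <-.
apply: eq_integral => p _; rewrite /G; congr (h _)%:E.
by apply/eqP; rewrite eq_complex/=; apply/andP; split; apply/eqP; ring.
Qed.

(* A rotation other than the half-turn is a product of three shears. *)
Lemma planar_integral_rotation h (w : cplx R) : nm w = 1 -> w != -1 ->
  planar_measurable h -> (forall z, 0 <= h z) ->
  planar_integral (fun z => h (w * z)) = planar_integral h.
Proof.
case: w => c s w1 wN1 mh h0; pose G (p : R * R) := (h (cplx_of p))%:E.
have cs : c ^+ 2 + s ^+ 2 = 1 by have := nm_sq (Complex c s); rewrite w1 expr1n.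
have c1 : 1 + c != 0.
  apply: contra wN1 => /eqP c1; have cE : c = -1 by lra.
  have : s ^+ 2 = 0 by move: cs; rewrite cE sqrrN expr1n; lra.
  by move=> /eqP; rewrite sqrf_eq0 eq_complex /= cE => /eqP ->; rewrite oppr0 !eqxx.
(* For w = exp(i theta), t is -tan(theta / 2); the rotation is the horizontal shear by t, the
   vertical one by s = sin theta, and the horizontal one again. *)
pose t := - s / (1 + c).
have mG : measurable_fun setT G by exact/measurable_EFinP.
have G0 p : (0 <= G p)%E by rewrite lee_fin.
pose sh1 (p : R * R) := (1 * p.1 + t * p.2, p.2).
pose sh2 (p : R * R) := (p.1, s * p.1 + 1 * p.2).
have msh1 : measurable_fun setT sh1.
  apply/measurable_fun_pair => //.
  by apply: measurable_funD; apply: measurable_funM.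
have msh2 : measurable_fun setT sh2.
  apply/measurable_fun_pair => //.
  by apply: measurable_funD; apply: measurable_funM.
have mG1 := measurableT_comp mG msh1.
have mG2 := measurableT_comp mG1 msh2.
have H1 := integral_plane_affine1 t (@ltr01 R) mG G0.
have H2 := integral_plane_affine2 s (@ltr01 R) mG1 (fun p => G0 _).
have H3 := integral_plane_affine1 t (@ltr01 R) mG2 (fun p => G0 _).
move: H3; rewrite H2 H1 invr1 !mul1e => E; rewrite [RHS]/planar_integral -[RHS]E.
apply: eq_integral => p _; rewrite /G /=; congr (h _)%:E.
(* Since 1 + c - s^2 = c (1 + c). *)
have st : 1 + s * t = c.
  have -> : 1 + s * t = (1 + c - s ^+ 2) / (1 + c) by rewrite /t; field.
  by apply: (mulIf c1); rewrite divfK//; have := cs; lra.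
have tc : t * (1 + c) = - s by rewrite /t divfK.
apply/eqP; rewrite eq_complex/=; apply/andP; split; apply/eqP.
  transitivity ((1 + s * t) * p.1 + (t * (1 + (1 + s * t))) * p.2); last by ring.
  by rewrite st tc; ring.
transitivity (s * p.1 + (1 + s * t) * p.2); last by ring.
by rewrite st; ring.
Qed.

End plane_integral.

(** * Moments of the disk *)

Section moments.
Variable R : realType.
Implicit Types (h : cplx R -> R).

(** With the cut-off inside the integrand, all integrals run over the whole plane and a change of
    variables need not track domains. *)
Definition disk_fun (r : R) h z : R := if nm z < r then h z else 0.

Definition disk_moment n := planar_integral (disk_fun 1 (fun z => nm z ^+ (2 * n))).

Lemma disk_fun_ge0 r h : (forall z, nm z < r -> 0 <= h z) -> forall z, 0 <= disk_fun r h z.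
Proof. by move=> h0 z; rewrite /disk_fun; case: ifP => // /h0. Qed.

Lemma nm_exp_ge0 (z : cplx R) n : 0 <= nm z ^+ n.
Proof. by rewrite exprn_ge0// nm_ge0. Qed.

#[local] Hint Resolve nm_exp_ge0 : core.

Lemma measurable_disk_exp (r : R) n : 0 <= r ->
  planar_measurable (disk_fun r (fun z => nm z ^+ (2 * n))).
Proof.
by move=> r0; apply: planar_measurable_disk => //; exact: planar_measurable_nm.
Qed.

(** Squares containing the disk and contained in it show that its area is finite and positive. *)
Definition square (r : R) (z : cplx R) : R :=
  \1_(`[- r, r]%classic `*` `[- r, r]%classic : set (R * R)) (complex.Re z, complex.Im z).

Lemma measurable_square r : planar_measurable (square r).
Proof.
apply: measurable_indic; exact: measurableX.
Qed.

Lemma integral_square (r : R) : 0 < r -> planar_integral (square r) = ((2 * r) ^+ 2)%:E.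
Proof.
move=> r0; rewrite /planar_integral /square.
transitivity (\int[@lebesgue_measure R \x @lebesgue_measure R]_p
  (\1_(`[- r, r]%classic `*` `[- r, r]%classic : set (R * R)) p)%:E)%E.
  by apply: eq_integral => -[].
rewrite integral_indic ?setIT//; last exact: measurableX.
have E : lebesgue_measure (`[- r, r]%classic : set R) = (2 * r)%:E.
  rewrite lebesgue_measure_itv/= lte_fin gtrN//= opprK -EFinD.
  by congr _%:E; ring.
apply: (etrans (product_measure1E _ _ _ _)) => //.
transitivity ((2 * r)%:E * (2 * r)%:E)%E; first by congr (_ * _)%E; exact: E.
by rewrite -EFinM expr2.
Qed.

Lemma disk_moment0_lty : (disk_moment 0 < +oo)%E.
Proof.
apply: (@le_lt_trans _ _ (planar_integral (square 1))); last first.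
  by rewrite integral_square// ltry.
apply: planar_integral_le.
- exact: measurable_disk_exp.
- exact: measurable_square.
- exact: disk_fun_ge0.
move=> z; rewrite /disk_fun; case: ifP => [z1|_]; last by rewrite /square indicE.
rewrite expr0 /square indicE mem_set//= !in_itv/= -!ler_norml.
by split; apply: le_trans (ltW z1); [exact: Re_le_nm | exact: Im_le_nm].
Qed.

Lemma disk_moment0_gt0 : (0 < disk_moment 0)%E.
Proof.
(* On this square |z| <= 1/4 + 1/4 < 1. *)
have r0 : 0 < 4^-1 :> R by rewrite invr_gt0.
apply: (@lt_le_trans _ _ (planar_integral (square 4^-1))).
  by rewrite integral_square// lte_fin exprn_gt0// mulr_gt0.
apply: planar_integral_le.
- exact: measurable_square.
- exact: measurable_disk_exp.
- by move=> z; rewrite /square indicE.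
move=> z; rewrite /square indicE /disk_fun.
case: (boolP (_ \in _)) => [|_]; last by case: ifP.
rewrite inE /= !in_itv/= -!ler_norml => -[zr zi].
have z1 : nm z < 1 by have := nm_le_ReIm z; lra.
by rewrite z1 muln0 expr0.
Qed.

Lemma disk_moment_ge0 n : (0 <= disk_moment n)%E.
Proof. by apply: planar_integral_ge0; exact: disk_fun_ge0. Qed.

Lemma disk_moment_fin n : disk_moment n \is a fin_num.
Proof.
rewrite ge0_fin_numE ?disk_moment_ge0//; apply: le_lt_trans disk_moment0_lty.
apply: planar_integral_le; try exact: measurable_disk_exp.
  exact: disk_fun_ge0.
move=> z; rewrite /disk_fun; case: ifP => // z1.
by rewrite expr0 exprn_ile1// ?nm_ge0// ltW.
Qed.

Definition moment n : R := fine (disk_moment n).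

Lemma momentE n : disk_moment n = (moment n)%:E.
Proof. by rewrite /moment fineK// disk_moment_fin. Qed.

Lemma moment_ge0 n : 0 <= moment n.
Proof. by rewrite -lee_fin -momentE disk_moment_ge0. Qed.

Lemma moment0_gt0 : 0 < moment 0.
Proof. by rewrite -lte_fin -momentE disk_moment0_gt0. Qed.

(** Substituting z / r yields r^(2n) from the integrand and r^2 from the area. *)
Lemma small_disk_moment (r : R) n : 0 < r ->
  planar_integral (disk_fun r (fun z => nm z ^+ (2 * n))) =
  (r ^+ (2 * n.+1) * moment n)%:E.
Proof.
move=> r0; have rV0 : 0 < r^-1 by rewrite invr_gt0.
have D0 : forall z : cplx R, 0 <= disk_fun 1 (fun z => nm z ^+ (2 * n)) z by exact:
  disk_fun_ge0.
have mD := @measurable_disk_exp 1 n ler01.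
rewrite (_ : disk_fun r _ = fun z => r ^+ (2 * n) *
    disk_fun 1 (fun z => nm z ^+ (2 * n)) (Complex r^-1 0 * z)); last first.
  apply/funext => z; rewrite /disk_fun nmM nm_real gtr0_norm// (mulrC r^-1)
    ltr_pdivrMr// mul1r.
  case: ifP => _; last by rewrite mulr0.
  by rewrite expr_div_n mulrC divfK// expf_neq0// gt_eqF.
rewrite planar_integralZ//; last 2 first.
- apply: (planar_measurable_comp mD); apply: cplx_measurableM.
    exact: cplx_measurable_cst.
  exact: cplx_measurable_id.
- by rewrite exprn_ge0// ltW.
rewrite planar_integral_dilation// -/(disk_moment n) momentE -!EFinM.
by rewrite exprVn invrK mulrA -exprD mulnS addnC.
Qed.

Lemma annulus_moment (r : R) n : 0 < r -> r < 1 ->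
  planar_integral (fun z => disk_fun 1 (fun z => nm z ^+ (2 * n)) z -
                            disk_fun r (fun z => nm z ^+ (2 * n)) z) =
  ((1 - r ^+ (2 * n.+1)) * moment n)%:E.
Proof.
move=> r0 r1; set A := planar_integral _.
have A0 z : 0 <= disk_fun 1 (fun z => nm z ^+ (2 * n)) z -
                 disk_fun r (fun z => nm z ^+ (2 * n)) z.
  rewrite subr_ge0 /disk_fun; case: ifP => zr; last by case: ifP.
  by rewrite (lt_trans zr r1).
have mA : planar_measurable (fun z => disk_fun 1 (fun z => nm z ^+ (2 * n)) z -
                 disk_fun r (fun z => nm z ^+ (2 * n)) z).
  by apply: measurable_funB; apply: measurable_disk_exp => //; exact: ltW.
have := planar_integralD mA (measurable_disk_exp n (ltW r0)) A0 (disk_fun_ge0 (fun z _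
  => nm_exp_ge0 z (2 * n))).
rewrite (_ : (fun z => _) = disk_fun 1 (fun z => nm z ^+ (2 * n))); last first.
  by apply/funext => z; rewrite subrK.
rewrite -/(disk_moment n) momentE small_disk_moment// -/A.
case: A => [x|//|//]; rewrite -EFinD => -[] E.
by rewrite mulrBl mul1r {1}E addrK.
Qed.

Lemma le_of_exp_near1 (A B : R) m :
  0 <= A -> (forall r, 0 < r -> r < 1 -> A * r ^+ m <= B) -> A <= B.
Proof.
move=> A0 AB; rewrite leNgt; apply/negP => BA.
have bern (x : R) k : 0 <= x -> x <= 1 -> 1 - k%:R * x <= (1 - x) ^+ k.
  move=> x0 x1; elim: k => [|k IH]; first by rewrite mul0r subr0 expr0.
  rewrite exprS -natr1; have x1' : 0 <= 1 - x by rewrite subr_ge0.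
  apply: le_trans (ler_wpM2l x1' IH).
  have : 0 <= k%:R :> R by []; nra.
have B0 : 0 <= B.
  by apply: le_trans (AB 2^-1 _ _);
    rewrite ?mulr_ge0 ?exprn_ge0 ?invr_ge0 ?invr_gt0 ?invf_lt1 ?ltr1n.
have Ap : 0 < A by lra.
have m0 : 0 < m.+1%:R :> R by rewrite ltr0n.
(* Then A m x < (A - B) / 2, so Bernoulli's inequality gives A (1 - x)^m > B; m + 1 avoids a zero
   divisor. *)
pose x := (A - B) / (2 * A * m.+1%:R).
have den : 0 < 2 * A * m.+1%:R by rewrite !mulr_gt0.
have x0 : 0 < x by rewrite divr_gt0// subr_gt0.
have x1 : x < 1.
  rewrite ltr_pdivrMr// mul1r; have : 1 <= m.+1%:R :> R by rewrite ler1n.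
  nra.
have : A * (1 - x) ^+ m <= B by apply: AB; rewrite ?subr_gt0 ?gtrBl.
apply/negP; rewrite -ltNge.
apply: lt_le_trans (ler_wpM2l A0 (bern x m (ltW x0) (ltW x1))).
have : A * (m.+1%:R * x) = (A - B) / 2 by rewrite /x; field; rewrite !gt_eqF.
have : 0 <= m%:R :> R by [].
rewrite -natr1 mulrDl mul1r; have := mulr_gt0 Ap x0; nra.
Qed.

(* The annulus r <= |z| < 1 has moment (1 - r^(2n+2)) I_n by dilation, and it
   lies between r^(2n) and 1 times its area; let r tend to 1. *)
Lemma moment_formula n : n.+1%:R * moment n = moment 0.
Proof.
(* This is (1 - r^(2n+2)) / (1 - r^2), which tends to n + 1 as r tends to 1. *)
pose S (r : R) := \sum_(i < n.+1) (r ^+ 2) ^+ i.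
have ann (r : R) : 0 < r -> r < 1 ->
    r ^+ (2 * n) * moment 0 <= S r * moment n <= moment 0.
  move=> r0 r1; have r2 : 0 < 1 - r ^+ 2 by rewrite subr_gt0 expr_lt1// ltW.
  have AE k : (1 - r ^+ (2 * k.+1)) = (1 - r ^+ 2) * \sum_(i < k.+1) (r ^+ 2) ^+ i.
    by rewrite -opprB exprM subrX1 -mulNr opprB.
  have pos k z : 0 <= disk_fun 1 (fun z => nm z ^+ (2 * k)) z -
                 disk_fun r (fun z : cplx R => nm z ^+ (2 * k)) z.
    rewrite subr_ge0 /disk_fun; case: ifP => zr; last by case: ifP.
    by rewrite (lt_trans zr r1).
  have mA k : planar_measurable (fun z => disk_fun 1 (fun z => nm z ^+ (2 * k)) z -
                 disk_fun r (fun z => nm z ^+ (2 * k)) z).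
    by apply: measurable_funB; apply: measurable_disk_exp => //; exact: ltW.
  have rn0 : 0 <= r ^+ (2 * n) by rewrite exprn_ge0// ltW.
  apply/andP; split.
    rewrite -(ler_pM2l r2) mulrCA (mulrA (1 - _)) -AE -[r ^+ 2]/(r ^+ (2 * 1)).
    rewrite -lee_fin EFinM -!annulus_moment// -planar_integralZ//.
    apply: planar_integral_le => //.
    - by apply: planar_measurableM => //; exact: measurable_cst.
    - by move=> z; rewrite mulr_ge0.
    move=> z; rewrite /disk_fun muln0 expr0.
    have [zr|rz] := ltP (nm z) r; first by rewrite (lt_trans zr r1) !subrr mulr0.
    case: ifP => _; rewrite !subr0 ?mulr0// mulr1.
    by rewrite lerXn2r ?nnegrE ?nm_ge0// ltW.
  rewrite -(ler_pM2l r2) (mulrA (1 - _)) -AE -[r ^+ 2]/(r ^+ (2 * 1)).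
  rewrite -lee_fin -!annulus_moment//.
  apply: planar_integral_le => // z; rewrite /disk_fun muln0 expr0.
  have [zr|rz] := ltP (nm z) r; first by rewrite (lt_trans zr r1) !subrr.
  case: ifP => z1; rewrite !subr0//.
  by rewrite exprn_ile1 ?nm_ge0// ltW.
apply/eqP; rewrite eq_le; apply/andP; split.
  apply: (@le_of_exp_near1 _ _ (2 * n)) => [|r r0 r1];
    first by rewrite mulr_ge0 ?moment_ge0.
  have /andP[_] := ann r r0 r1; apply: le_trans.
  rewrite mulrAC ler_wpM2r ?moment_ge0//.
  rewrite -{1}(card_ord n.+1) mulr_natl -sumr_const; apply: ler_sum => i _.
  rewrite exprM ler_wiXn2l ?sqr_ge0//; last by rewrite -ltnS.
  by rewrite expr_le1// ltW.
apply: (@le_of_exp_near1 _ _ (2 * n)) => [|r r0 r1]; first exact: moment_ge0.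
have /andP[+ _] := ann r r0 r1; rewrite mulrC => /le_trans; apply.
rewrite ler_wpM2r ?moment_ge0//.
rewrite -{1}(card_ord n.+1) -sumr_const; apply: ler_sum => i _.
by rewrite exprn_ile1 ?sqr_ge0// expr_le1// ltW.
Qed.

End moments.

(** * The weighted Parseval identity *)

Section weighted.
Variable R : realType.
Implicit Types (h : cplx R -> R) (a : nat -> cplx R) (f : cplx R -> cplx R).

Definition weight (z : cplx R) : R := 2 * (1 - nm z ^+ 2) * pi^-1.

Definition weighted_integral h := planar_integral (disk_fun 1 (fun z => h z * weight z)).

Lemma integral_dA1E h : integral_dA1 h = weighted_integral h.
Proof.
rewrite /integral_dA1 integral_mkcond; apply: eq_integral => p _.
rewrite patchE /disk_fun; case: ifPn => [|]; rewrite ?notin_setE ?inE /= unit_diskE.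
  by move=> ->.
by move=> /negP/negbTE ->.
Qed.

Lemma weight_ge0 z : nm z < 1 -> 0 <= weight z.
Proof.
move=> z1; rewrite /weight mulr_ge0 ?invr_ge0 ?pi_ge0// mulr_ge0// subr_ge0.
by rewrite expr_le1// ?nm_ge0// ltW.
Qed.

Lemma weighted_ge0 h : (forall z, nm z < 1 -> 0 <= h z) ->
  forall z, 0 <= disk_fun 1 (fun z => h z * weight z) z.
Proof. by move=> h0; apply: disk_fun_ge0 => z z1; rewrite mulr_ge0 ?h0 ?weight_ge0. Qed.

Lemma measurable_weight : planar_measurable weight.
Proof.
apply: planar_measurableM; last exact: measurable_cst.
apply: planar_measurableM; first exact: measurable_cst.
apply: measurable_funB; first exact: measurable_cst.
exact: planar_measurable_sq (@cplx_measurable_id R).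
Qed.

Lemma measurable_weighted h : planar_measurable h ->
  planar_measurable (disk_fun 1 (fun z => h z * weight z)).
Proof.
move=> mh; apply: planar_measurable_disk => //.
by apply: planar_measurableM => //; exact: measurable_weight.
Qed.

(** Two over pi times the area of the unit disk, kept as a symbolic positive constant. *)
Definition weight_const : R := 2 * pi^-1 * moment R 0.

Lemma weight_const_gt0 : 0 < weight_const.
Proof. by rewrite !mulr_gt0 ?invr_gt0 ?pi_gt0 ?moment0_gt0. Qed.

(** The factor 1 - |z|^2 turns this into a difference of consecutive moments, and 1/(n+1) - 1/(n+2)
    = 1/((n+1)(n+2)). The subtraction is done on finite values, after adding nonnegative
    integrands. *)
Lemma weight_moment n :
  weighted_integral (fun z => nm z ^+ (2 * n)) =
  (weight_const / (n.+1%:R * n.+2%:R))%:E.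
Proof.
have k0 : 0 <= 2 * pi^-1 :> R by rewrite mulr_ge0 ?invr_ge0 ?pi_ge0.
have mD k := @measurable_disk_exp R 1 k ler01.
have D0 k : forall z : cplx R, 0 <= disk_fun 1 (fun z => nm z ^+ (2 * k)) z.
  by apply: disk_fun_ge0 => z _; exact: nm_exp_ge0.
have mW := measurable_weighted (planar_measurable_nm n).
have W0 := weighted_ge0 (fun z _ => nm_exp_ge0 z (2 * n)).
have mE : planar_measurable (fun z : cplx R => 2 * pi^-1 * disk_fun 1 (fun z => nm z ^+
  (2 * n.+1)) z).
  by apply: planar_measurableM => //; exact: measurable_cst.
have E0 (z : cplx R) : 0 <= 2 * pi^-1 * disk_fun 1 (fun z => nm z ^+ (2 * n.+1)) z.
  by rewrite mulr_ge0.
have := planar_integralD mW mE W0 E0.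
rewrite (_ : (fun z => _ + _) =
  fun z : cplx R => 2 * pi^-1 * disk_fun 1 (fun z => nm z ^+ (2 * n)) z); last first.
  apply/funext => z; rewrite /disk_fun /weight; case: ifP => _; last by rewrite mulr0 addr0.
  by rewrite mulnS exprD; ring.
rewrite !planar_integralZ// -!/(disk_moment R _) !momentE -/(weighted_integral _).
case: (weighted_integral _) => [x|//|//]; rewrite -!EFinM -EFinD => -[] E.
have n1 : n.+1%:R != 0 :> R by rewrite pnatr_eq0.
have n2 : n.+2%:R != 0 :> R by rewrite pnatr_eq0.
have M1 : moment R n = moment R 0 / n.+1%:R by rewrite -(moment_formula R n) mulrC mulKf.
have M2 : moment R n.+1 = moment R 0 / n.+2%:R by rewrite -(moment_formula R n.+1)
  mulrC mulKf.
congr _%:E; have -> : x = 2 * pi^-1 * moment R n - 2 * pi^-1 * moment R n.+1 by rewrite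
  E addrK.
have key : (n.+1%:R * n.+2%:R)^-1 = n.+1%:R^-1 - n.+2%:R^-1 :> R.
  move: n1 n2; rewrite -(natr1 n.+1); move: (n.+1%:R : R) => y y0 y1.
  by field; apply/andP; split.
by rewrite M1 M2 /weight_const key; ring.
Qed.

(** Applying the rotation by w one step at a time means that only w, and not its powers, has to
    differ from -1. *)
Lemma weighted_rotation h (w : cplx R) k : nm w = 1 -> w != -1 ->
  planar_measurable h -> (forall z, 0 <= h z) ->
  weighted_integral (fun z => h (w ^+ k * z)) = weighted_integral h.
Proof.
move=> w1 wN1 mh h0; elim: k => [|k IH].
  by congr weighted_integral; apply/funext => z; rewrite expr0 mul1r.
rewrite -IH /weighted_integral.
pose g := disk_fun 1 (fun z => h (w ^+ k * z) * weight z).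
have mhk : planar_measurable (fun z => h (w ^+ k * z)).
  apply: (planar_measurable_comp mh); apply: cplx_measurableM.
    exact: cplx_measurable_cst.
  exact: cplx_measurable_id.
rewrite -(@planar_integral_rotation _ g w)//; last 2 first.
- exact: measurable_weighted.
- exact: weighted_ge0.
congr planar_integral; apply/funext => z.
by rewrite /g /disk_fun /weight nmM w1 mul1r mulrA -exprSr.
Qed.

Lemma weighted_sum (I : Type) (r : seq I) (H : I -> cplx R -> R) :
  (forall i, planar_measurable (H i)) -> (forall i z, 0 <= H i z) ->
  weighted_integral (fun z => \sum_(i <- r) H i z) = (\sum_(i <- r) weighted_integral
    (H i))%E.
Proof.
move=> mH H0; rewrite -planar_integral_sum; last 2 first.
- by move=> i; exact: measurable_weighted.
- by move=> i; exact: weighted_ge0.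
congr planar_integral; apply/funext => z; rewrite /disk_fun mulr_suml.
by case: ifP => // _; rewrite big1.
Qed.

Lemma weightedZ h (c : R) : planar_measurable h -> (forall z, 0 <= h z) -> 0 <= c ->
  weighted_integral (fun z => c * h z) = (c%:E * weighted_integral h)%E.
Proof.
move=> mh h0 c0; rewrite -planar_integralZ//; last 2 first.
- exact: measurable_weighted.
- exact: weighted_ge0.
congr planar_integral; apply/funext => z; rewrite /disk_fun.
by case: ifP => _; rewrite ?mulr0// mulrA.
Qed.

Lemma measurable_poly_sq a N : planar_measurable (fun z => nm (\sum_(0 <= n < N) a n *
  z ^+ n) ^+ 2).
Proof. by apply: planar_measurable_sq; exact: cplx_measurable_poly. Qed.

(* Averaging over the rotations by the M-th roots of unity removes the
   off-diagonal terms.  M is odd so that -1 is not one of the rotations. *)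
Lemma weighted_parseval a N :
  weighted_integral (fun z => nm (\sum_(0 <= n < N) a n * z ^+ n) ^+ 2) =
  (\sum_(0 <= n < N) nm (a n) ^+ 2 * (weight_const / (n.+1%:R * n.+2%:R)))%:E.
Proof.
pose S z := nm (\sum_(0 <= n < N) a n * z ^+ n) ^+ 2.
have mS : planar_measurable S by exact: measurable_poly_sq.
have S0 z : 0 <= S z by exact: sqr_ge0.
(* M exceeds every exponent, so distinct exponents remain distinct modulo M. *)
pose M := (2 * N).+1; have [w wM] := prim_root_exists R (ltn0Sn (2 * N)).
have w1 := nm_prim_root wM.
have wN1 : w != -1.
  apply/negP => /eqP wE; have := prim_expr_order wM.
  rewrite wE exprS exprM sqrrN !expr1n mulr1 => -[]; lra.
have sumS z : \sum_(0 <= k < M) S (w ^+ k * z) =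
    M%:R * \sum_(0 <= n < N) nm (a n) ^+ 2 * nm z ^+ (2 * n).
  have NM : (N <= M)%N by rewrite /M ltnW// ltnS leq_pmull.
  pose b i : cplx R := if (i < N)%N then a i * z ^+ i else 0.
  transitivity (\sum_(0 <= k < M) nm (\sum_(0 <= i < M) b i * w ^+ (k * i)) ^+ 2).
    apply: eq_bigr => k _; rewrite /S (big_nat_widen _ _ _ _ _ NM) big_mkcond/=.
    congr (nm _ ^+ 2); apply: eq_bigr => i _; rewrite /b; case: ifP => _;
      last by rewrite mul0r.
    by rewrite exprMn exprM -mulrA (mulrC (_ ^+ i)).
  rewrite (prim_root_parseval b wM); congr (_ * _).
  rewrite [RHS](big_nat_widen _ _ _ _ _ NM) [RHS]big_mkcond/=.
  apply: eq_bigr => i _; rewrite /b; case: ifP => _; last by rewrite nm0 expr0n.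
  by rewrite nmM nmX exprMn -!exprM mulnC.
have M0 : 0 < M%:R :> R by rewrite ltr0n.
pose T i (z : cplx R) : R := nm (a i) ^+ 2 * nm z ^+ (2 * i).
have mT i : planar_measurable (T i).
  apply: planar_measurableM; first exact: measurable_cst.
  exact: planar_measurable_nm.
have T0 i z : 0 <= T i z by rewrite mulr_ge0 ?sqr_ge0 ?nm_exp_ge0.
have E1 : weighted_integral (fun z => \sum_(0 <= k < M) S (w ^+ k * z)) =
    (M%:R%:E * weighted_integral S)%E.
  rewrite (@weighted_sum _ (index_iota 0 M) (fun k z => S (w ^+ k * z)))//; last first.
    move=> k; apply: (planar_measurable_comp mS); apply: cplx_measurableM.
      exact: cplx_measurable_cst.
    exact: cplx_measurable_id.
  under eq_bigr do rewrite weighted_rotation//.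
  by rewrite (sumr_const_nat _ _ (weighted_integral S)) subn0 mule_natl.
have E2 : weighted_integral (fun z => \sum_(0 <= k < M) S (w ^+ k * z)) =
    (M%:R%:E * (\sum_(0 <= n < N) nm (a n) ^+ 2 * (weight_const / (n.+1%:R *
      n.+2%:R)))%:E)%E.
  rewrite (_ : (fun z => _) = fun z => M%:R * \sum_(0 <= n < N) T n z); last first.
    by apply/funext => z; exact: sumS.
  rewrite weightedZ//; last 2 first.
  - rewrite /planar_measurable.
    elim: N {S mS S0 M w wM w1 wN1 sumS M0 E1} => [|N IH].
      by under eq_fun do rewrite big_geq//; exact: measurable_cst.
    under eq_fun do rewrite big_nat_recr//.
    exact: (measurable_funD IH (mT N)).
  - by move=> z; exact: sumr_ge0.
  rewrite weighted_sum// -sumEFin; congr (_ * _)%E; apply: eq_bigr => i _.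
  rewrite weightedZ ?sqr_ge0//; last 2 first.
  - exact: planar_measurable_nm.
  - by move=> z; exact: nm_exp_ge0.
  by rewrite weight_moment EFinM.
move: E2; rewrite E1 -/S => E.
have : (M%:R^-1%:E * (M%:R%:E * weighted_integral S) =
  M%:R^-1%:E * (M%:R%:E * (\sum_(0 <= n < N) nm (a n) ^+ 2 * (weight_const / (n.+1%:R *
    n.+2%:R)))%:E))%E.
  by rewrite E.
by rewrite !muleA -EFinM mulVf ?gt_eqF// !mul1e.
Qed.

End weighted.

(** * Norms and coefficients *)

Section norm_coefficients.
Variable R : realType.
Implicit Types (a b : nat -> cplx R) (f : cplx R -> cplx R).

Definition energy f := weighted_integral (fun z => nm (f z) ^+ 2).

Lemma ccvg_nm (x : nat -> cplx R) l : ccvg x l -> (fun N => nm (x N)) @ \oo --> nm l.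
Proof.
move=> /cvgr0Pnorm_lt xl; apply/cvgrPdist_le => e e0; apply: filterS (xl _ e0) => N.
rewrite ger0_norm ?nm_ge0// => /ltW xe; apply: le_trans xe.
have h1 : nm (x N) <= nm (x N - l) + nm l by have := nmD (x N - l) l; rewrite subrK.
have h2 : nm l <= nm (x N - l) + nm (x N).
  by have := nmD (l - x N) (x N); rewrite subrK -(nmN (l - _)) opprB.
by rewrite ler_norml; apply/andP; split; lra.
Qed.

Lemma sums_to_cvg f a (z : cplx R) : sums_to f a 1 ->
  (fun N => disk_fun 1 (fun z => nm (\sum_(0 <= n < N) a n * z ^+ n) ^+ 2 * weight z)
    z) @ \oo -->
  disk_fun 1 (fun z => nm (f z) ^+ 2 * weight z) z.
Proof.
move=> af; rewrite /disk_fun; case: ifP => z1; last exact: cvg_cst.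
apply: cvgMl; rewrite expr2; under eq_fun do rewrite expr2.
by apply: cvgM; apply: ccvg_nm; exact: af.
Qed.

Lemma measurable_sums_to f a : sums_to f a 1 ->
  planar_measurable (disk_fun 1 (fun z => nm (f z) ^+ 2 * weight z)).
Proof.
move=> af; apply: (measurable_fun_cvg (h := fun N p => disk_fun 1
    (fun z => nm (\sum_(0 <= n < N) a n * z ^+ n) ^+ 2 * weight z) (cplx_of p))).
  by move=> N; apply: measurable_weighted; exact: measurable_poly_sq.
by move=> p _; exact: sums_to_cvg.
Qed.

(** Fatou's lemma along the Taylor polynomials, whose energies are known from
    [weighted_parseval]. *)
Lemma weighted_sums_to_le f a B : sums_to f a 1 ->
  (forall N, \sum_(0 <= n < N) nm (a n) ^+ 2 * (weight_const R / (n.+1%:R * n.+2%:R))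
    <= B) ->
  (energy f <= B%:E)%E.
Proof.
move=> af aB.
pose F N (p : R * R) := (disk_fun 1
  (fun z => nm (\sum_(0 <= n < N) a n * z ^+ n) ^+ 2 * weight z) (cplx_of p))%:E.
have mF N : measurable_fun setT (F N).
  by apply/measurable_EFinP; apply: measurable_weighted; exact: measurable_poly_sq.
have F0 N p : (0 <= F N p)%E.
  by rewrite lee_fin; apply: weighted_ge0 => z _; exact: sqr_ge0.
have IF N : (\int[@lebesgue_measure R \x @lebesgue_measure R]_p F N p =
    (\sum_(0 <= n < N) nm (a n) ^+ 2 * (weight_const R / (n.+1%:R * n.+2%:R)))%:E)%E.
  exact: weighted_parseval.
have := fatou (@lebesgue_measure R \x @lebesgue_measure R)%E measurableT mF (fun N p _
  => F0 N p).
rewrite [leLHS](_ : _ = energy f); last first.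
  apply: eq_integral => p _.
  have Fp : F ^~ p @ \oo --> (disk_fun 1 (fun z => nm (f z) ^+ 2 * weight z) (cplx_of
    p))%:E.
    by apply: cvg_EFin; [exact: nearW | exact: (sums_to_cvg af)].
  by rewrite is_cvg_limn_einfE; [exact/cvg_lim | apply/cvg_ex; eexists; exact: Fp].
move=> /le_trans; apply.
under eq_fun do rewrite IF.
have nd : {homo (fun N => (\sum_(0 <= n < N) nm (a n) ^+ 2 * (weight_const R / (n.+1%:R
  * n.+2%:R)))%:E) :
   n m / (n <= m)%N >-> (n <= m)%E}.
  move=> n m nm_; rewrite lee_fin (big_cat_nat (n := n) (p := m))//= lerDl.
  apply: sumr_ge0 => i _; rewrite mulr_ge0 ?sqr_ge0// divr_ge0//.
  exact/ltW/weight_const_gt0.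
have cv := ereal_nondecreasing_is_cvgn nd.
rewrite is_cvg_limn_einfE//; apply: lime_le => //.
by apply: nearW => N; rewrite lee_fin.
Qed.

Lemma weight_le (z : cplx R) (r : R) : 0 <= r -> r <= 1 -> weight z <= weight (Complex
  r 0 * z).
Proof.
move=> r0 r1; rewrite /weight ler_wpM2r ?invr_ge0 ?pi_ge0// ler_wpM2l// lerD2l lerN2.
rewrite nmM nm_real ger0_norm// lerXn2r ?nnegrE ?mulr_ge0 ?nm_ge0//.
by rewrite ler_piMl ?nm_ge0.
Qed.

Lemma sums_to_uniform f a (r : R) N : sums_to f a 1 -> 0 <= r -> r < 1 ->
  exists2 K, (N <= K)%N & forall z, nm z <= r ->
    nm (\sum_(0 <= n < K) a n * z ^+ n - f z) <= 1.
Proof.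
move=> af r0 r1; pose t := (r + 1) / 2; have t0 : 0 < t by rewrite /t; lra.
have [|M aM] := sums_to_bounded af (ltW t0); first by rewrite /t; lra.
have q01 : 0 <= r / t < 1.
  by rewrite divr_ge0 ?(ltW t0)//= ltr_pdivrMr// mul1r /t; lra.
have /cvgr0Pnorm_lt/(_ _ ltr01)[K _ epsK] := geometric_tail_cvg M q01.
exists (maxn K N); rewrite ?leq_maxr// => z zr.
have M0 : 0 <= M by apply: le_trans (aM 0%N); rewrite mulr_ge0 ?nm_ge0// expr0.
have dom m : nm (a m * z ^+ m) <= M * (r / t) ^+ m.
  apply: le_trans (coef_bounded_term z m t0 aM) _; rewrite ler_wpM2l//.
  have tV : 0 <= t^-1 by rewrite invr_ge0 ltW.
  by apply: lerXn2r; rewrite ?nnegrE ?mulr_ge0 ?nm_ge0// ler_wpM2r.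
have := csum_tail (maxn K N) q01 dom (af _ (le_lt_trans zr r1)).
rewrite -nmN opprB => /le_trans; apply; apply/ltW.
have /= := epsK (maxn K N) (leq_maxl _ _); apply: le_lt_trans.
exact: ler_norm.
Qed.

(** The Taylor series need not converge uniformly up to the boundary, so f is first dilated: f(r z)
    is within 1 of a polynomial on the whole disk. The energy of that polynomial is at most 2 r^-2 v
    + 2 W, since dilation costs r^-2 and the weight only grows towards the centre. Then r tends to
    1. *)
Lemma sums_to_bessel f a v : sums_to f a 1 ->
  energy f = v%:E ->
  exists B, l2bounded a B.
Proof.
move=> af fv; pose W := weight_const R / (1%:R * 2%:R).
have W0 : 0 < W by rewrite divr_gt0// weight_const_gt0.
pose E N := \sum_(0 <= n < N) nm (a n) ^+ 2 * (weight_const R / (n.+1%:R * n.+2%:R)).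
have term_ge0 (b : nat -> cplx R) n : 0 <= nm (b n) ^+ 2 * (weight_const R / (n.+1%:R *
  n.+2%:R)).
  by rewrite mulr_ge0 ?sqr_ge0// divr_ge0 ?(ltW (weight_const_gt0 R))// mulr_ge0.
have E0 N : 0 <= E N by apply: sumr_ge0 => n _.
have Ebound N : E N <= 2 * v + 2 * W.
  (* Of the exponent 2 (N + 1), 2 N pays for the dilated coefficients and 2 for the Jacobian. *)
  apply: (@le_of_exp_near1 _ _ _ (2 * N.+1)) => // r r0 r1.
  have [K NK unif] := sums_to_uniform N af (ltW r0) r1.
  pose ar n := a n * Complex r 0 ^+ n.
  have arS z : \sum_(0 <= n < K) ar n * z ^+ n = \sum_(0 <= n < K) a n * (Complex r 0 *
    z) ^+ n.
    by apply: eq_bigr => n _; rewrite /ar exprMn mulrA.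
  pose g := disk_fun 1 (fun z => nm (f z) ^+ 2 * weight z).
  have mg : planar_measurable g := measurable_sums_to af.
  have g0 z : 0 <= g z by apply: weighted_ge0 => ? _; exact: sqr_ge0.
  have mgr : planar_measurable (fun z => g (Complex r 0 * z)).
    apply: (planar_measurable_comp mg); apply: cplx_measurableM.
      exact: cplx_measurable_cst.
    exact: cplx_measurable_id.
  pose u (z : cplx R) : R := disk_fun 1 (fun z => nm z ^+ (2 * 0) * weight z) z.
  have mu_ : planar_measurable u.
    by apply: measurable_weighted; exact: planar_measurable_nm.
  have u0 z : 0 <= u z by apply: weighted_ge0 => ? _; exact: nm_exp_ge0.
  have Iu : planar_integral u = W%:E by exact: weight_moment.
  have up : (energy (fun z => \sum_(0 <= n < K) ar n * z ^+ n)%R <=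
      planar_integral (fun z => 2 * g (Complex r 0 * z) + 2 * u z)%R)%E.
    apply: planar_integral_le.
    - by apply: measurable_weighted; exact: measurable_poly_sq.
    - by apply: measurable_funD; apply: measurable_funM => //; exact: measurable_cst.
    - by apply: weighted_ge0 => ? _; exact: sqr_ge0.
    move=> z; rewrite {1}/disk_fun; case: ifP => z1; last by rewrite addr_ge0// mulr_ge0.
    have rz : nm (Complex r 0 * z) <= r.
      rewrite nmM nm_real gtr0_norm//; apply: ler_piMr; [exact: ltW | exact: ltW].
    rewrite /g /u /disk_fun z1 (le_lt_trans rz r1) muln0 expr0 mul1r arS.
    set S := \sum_(0 <= n < K) _.
    have fS : nm S ^+ 2 <= 2 * nm (f (Complex r 0 * z)) ^+ 2 + 2.
      have := nm_sqD (f (Complex r 0 * z)) (S - f (Complex r 0 * z)); rewrite subrKC.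
      move=> /le_trans; apply; rewrite lerD2l ler_piMr// expr_le1 ?nm_ge0//.
      exact: unif.
    apply: le_trans (ler_wpM2r (weight_ge0 z1) fS) _.
    rewrite mulrDl lerD2r -mulrA ler_wpM2l// ler_wpM2l ?sqr_ge0//.
    by apply: weight_le; exact: ltW.
  move: up; rewrite /energy weighted_parseval planar_integralD//; last 4 first.
  - by apply: measurable_funM => //; exact: measurable_cst.
  - by apply: measurable_funM => //; exact: measurable_cst.
  - by move=> z; rewrite mulr_ge0.
  - by move=> z; rewrite mulr_ge0.
  rewrite !planar_integralZ// Iu planar_integral_dilation// [planar_integral g]fv.
  rewrite -!EFinM -EFinD lee_fin => up.
  have r20 : 0 < r ^+ 2 by rewrite exprn_gt0.
  have r21 : r ^+ 2 <= 1 by rewrite expr_le1// ltW.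
  have low : E N * r ^+ (2 * N) <= 2 * (r ^- 2 * v) + 2 * W.
    apply: le_trans up; apply: (@le_trans _ _ (\sum_(0 <= n < N) nm (ar n) ^+ 2 *
       (weight_const R / (n.+1%:R * n.+2%:R)))).
      rewrite /E mulr_suml !big_nat; apply: ler_sum => n /andP[_ nN].
      rewrite /ar nmM nmX nm_real gtr0_norm// exprMn mulrAC ler_wpM2r//.
        by rewrite divr_ge0 ?(ltW (weight_const_gt0 R))// mulr_ge0.
      rewrite ler_wpM2l ?sqr_ge0// -exprM mulnC ler_wiXn2l ?(ltW r0) ?(ltW r1)//.
      by rewrite leq_pmul2r// ltnW.
    by rewrite [leRHS](big_cat_nat (n := N))//= lerDl sumr_ge0.
  rewrite mulnS exprD mulrCA.
  apply: le_trans (ler_wpM2l (ltW r20) low) _.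
  rewrite mulrDr (mulrCA _ 2) mulVKf ?gt_eqF// lerD2l.
  by rewrite ler_piMl// mulr_ge0// ltW.
exists (2 * (2 * v + 2 * W) / weight_const R) => N.
rewrite ler_pdivlMr ?weight_const_gt0//.
apply: le_trans (ler_wpM2l _ (Ebound N)) => //.
rewrite /E mulr_suml mulr_sumr; apply: ler_sum => n _.
have n1 : 0 < n.+1%:R :> R by rewrite ltr0n.
have n2 : 0 < n.+2%:R :> R by rewrite ltr0n.
(* The two weights are comparable because n + 2 <= 2 (n + 1). *)
have key : (n.+1%:R ^+ 2)^-1 <= 2 * (n.+1%:R * n.+2%:R)^-1 :> R.
  rewrite ler_pdivlMr ?mulr_gt0// mulrC ler_pdivrMr ?exprn_gt0//.
  by rewrite expr2 mulrCA ler_pM2l// -natrM ler_nat mul2n -addnn addSn addnS !ltnS leq_addr.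
have c0 : 0 <= nm (a n) ^+ 2 * weight_const R.
  by rewrite mulr_ge0 ?sqr_ge0// ltW// weight_const_gt0.
apply: le_trans (le_trans _ (ler_wpM2l c0 key)) _.
  by rewrite mulrAC.
by rewrite mulrCA -!mulrA.
Qed.

Lemma l2bounded_weighted a B : l2bounded a B -> forall N,
  \sum_(0 <= n < N) nm (a n) ^+ 2 * (weight_const R / (n.+1%:R * n.+2%:R)) <=
    weight_const R * B.
Proof.
move=> aB N; apply: le_trans (ler_wpM2l (ltW (weight_const_gt0 R)) (aB N)).
rewrite mulr_sumr; apply: ler_sum => n _.
rewrite mulrCA ler_wpM2l ?(ltW (weight_const_gt0 R))// ler_wpM2l ?sqr_ge0//.
rewrite lef_pV2 ?posrE ?exprn_gt0 ?mulr_gt0 ?ltr0n// expr2 ler_wpM2l// ler_nat.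
exact: leqnSn.
Qed.

Lemma norm2_le f a (e : R) : sums_to f a 1 -> 0 <= e ->
  l2bounded a (e ^+ 2 / weight_const R) -> (norm2 f <= e%:E)%E.
Proof.
move=> af e0 /l2bounded_weighted aB; have k0 := weight_const_gt0 R.
have := weighted_sums_to_le af aB;
  rewrite /energy -integral_dA1E mulrCA divff ?gt_eqF// mulr1 => le2.
have -> : e%:E = ((e ^+ 2)%:E `^ 2^-1)%E.
  by rewrite poweR_EFin powR12_sqrt ?sqr_ge0// sqrtr_sqr ger0_norm.
have i0 : (0 <= integral_dA1 (fun z => nm (f z) ^+ 2)%R)%E.
  by rewrite integral_dA1E; apply: planar_integral_ge0; apply: weighted_ge0 => z _;
    exact: sqr_ge0.
apply: gt0_ler_poweR le2; rewrite ?invr_ge0// in_itv/= leey andbT//.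
by rewrite lee_fin sqr_ge0.
Qed.

End norm_coefficients.

(** * The power series of the functions f_k *)

Section fk_series.
Variable R : realType.

(** This is the logarithmic derivative of (1 - z^k) / (1 - z), checked algebraically: multiplied by
    1 - z, the numerator of [fk] telescopes. *)
Lemma fk_closed k (z : cplx R) : nm z < 1 -> (0 < k)%N ->
  fk k z = (1 - z)^-1 - k%:R * z ^+ k.-1 / (1 - z ^+ k).
Proof.
move=> z1 k0; rewrite /fk.
have zk1 m : (0 < m)%N -> 1 - z ^+ m != 0.
  move=> m0; rewrite subr_eq0; apply/eqP => /(congr1 (@nm R)); rewrite nm1 nmX => E.
  by have := expr_lt1 m0 (nm_ge0 z); rewrite z1 -E ltxx.
have z10 : 1 - z != 0 by rewrite -(expr1 z) zk1.
have geo : (1 - z) * \sum_(0 <= j < k) z ^+ j = 1 - z ^+ k.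
  by rewrite big_mkord -opprB mulNr -subrX1 opprB.
have num : (1 - z) * \sum_(1 <= j < k) j%:R * z ^+ j.-1 =
    \sum_(0 <= j < k) z ^+ j - k%:R * z ^+ k.-1.
  case: k k0 {geo} => // k _; elim: k => [|k IH].
    by rewrite big_geq// big_nat1 mulr0 !expr0 mulr1 subrr.
  rewrite big_nat_recr//= mulrDr IH [in RHS]big_nat_recr//= -(natr1 k.+1) exprS.
  by ring.
have s0 : \sum_(0 <= j < k) z ^+ j != 0.
  by apply: contra (zk1 k k0) => /eqP s0; rewrite -geo s0 mulr0.
apply: (mulfI z10); apply: (mulIf s0); rewrite -[LHS]mulrA divfK// num -geo.
move: s0; move: (\sum_(0 <= j < k) z ^+ j) => S s0.
by field; apply/andP; split.
Qed.

Lemma geometric_csum (z : cplx R) : nm z < 1 -> csum (fun n => z ^+ n) (1 - z)^-1.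
Proof.
move=> z1; have z10 : 1 - z != 0.
  rewrite subr_eq0; apply/eqP => /(congr1 (@nm R)); rewrite nm1 => E.
  by rewrite -E ltxx in z1.
have q0 : 0 <= nm z < 1 by rewrite nm_ge0.
have := geometric_tail_cvg (nm (1 - z)^-1 * (1 - nm z)) q0.
move=> /ccvg_squeeze; apply => N.
rewrite (_ : _ - _ = - (z ^+ N / (1 - z))); last first.
  apply: (mulIf z10); rewrite mulrBl mulVf// mulNr divfK// mulrC big_mkord.
  have := subrX1 z N; move: (\sum_(i < N) z ^+ i) => S E.
  by have : (1 - z) * S = - (z ^+ N - 1); [rewrite E; ring | move=> ->; ring].
rewrite nmN nmM nmX mulrC -mulrA ler_wpM2l ?nm_ge0// mulrC divfK//.
by rewrite gt_eqF// subr_gt0.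
Qed.

(** The N-th partial sum is the partial sum of length N / k of a geometric series in z^k, and N / k
    tends to infinity with N. *)
Lemma mult_coef_csum k (z : cplx R) : nm z < 1 -> (0 < k)%N ->
  csum (fun n => mult_coef R k n * z ^+ n) (k%:R * z ^+ k.-1 / (1 - z ^+ k)).
Proof.
move=> z1 k0; have zk : nm (z ^+ k) < 1 by rewrite nmX expr_lt1// nm_ge0.
have := csumZ (k%:R * z ^+ k.-1) (geometric_csum zk).
move=> /ccvgP sub; apply/ccvgP.
rewrite (_ : (fun N => _) = (fun N => \sum_(0 <= n < N) k%:R * z ^+ k.-1 * z ^+ k ^+ n)
  \o (fun N => (N %/ k)%N)).
  apply: cvg_comp sub; move=> P [N _ NP]; exists (N * k)%N => // n /= Nn.
  by apply: NP => /=; rewrite leq_divRL.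
apply/funext => N /=; elim: N => [|N IH]; first by rewrite div0n !big_geq.
rewrite big_nat_recr//= IH divnS// /mult_coef.
case: (boolP (k %| N.+1)%N) => kN; last by rewrite mul0r addr0 add0n.
rewrite add1n [RHS]big_nat_recr//=; congr (_ + _).
rewrite -mulrA -exprM -exprD; congr (_ * _ ^+ _).
have NE : N.+1 = ((N %/ k).+1 * k)%N.
  by rewrite -{1}(divnK kN) divnS// kN add1n.
by apply/eqP; rewrite -eqSS NE mulSn -addSn prednK// mulnC.
Qed.

Lemma fk_sums_to k : (0 < k)%N -> sums_to (fk k) (fk_coef R k) 1.
Proof.
move=> k0 z z1; rewrite fk_closed//.
have := csumD (geometric_csum z1) (csumZ (-1) (mult_coef_csum z1 k0)).
rewrite mulN1r (_ : _ \+ _ = fun n => fk_coef R k n * z ^+ n)//.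
by apply/funext => n /=; rewrite /fk_coef mulN1r mulrBl mul1r.
Qed.

Lemma span_sums_to (c : nat -> cplx R) N :
  sums_to (fun z => \sum_(2 <= k < N) c k * fk k z)
          (fun n => \sum_(2 <= k < N) c k * fk_coef R k n) 1.
Proof.
elim: N => [|N IH] z z1.
  have := csumZ 0 (geometric_csum z1); rewrite mul0r big_geq//.
  by rewrite (_ : (fun n => 0 * _) = fun n => (\sum_(2 <= k < 0) c k * fk_coef R k n) *
    z ^+ n)//;
    apply/funext => n; rewrite big_geq// !mul0r.
have [N2|N2] := ltnP N 2.
  have := csumZ 0 (geometric_csum z1); rewrite mul0r big_geq//.
  by rewrite (_ : (fun n => 0 * _) = fun n => (\sum_(2 <= k < N.+1) c k * fk_coef R k
    n) * z ^+ n)//;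
    apply/funext => n; rewrite big_geq// !mul0r.
rewrite big_nat_recr//=.
have := csumD (IH z z1) (csumZ (c N) (fk_sums_to (ltnW N2) z1)).
rewrite (_ : _ \+ _ = fun n => (\sum_(2 <= k < N.+1) c k * fk_coef R k n) * z ^+ n)//.
by apply/funext => n /=; rewrite big_nat_recr//= [RHS]mulrDl mulrA.
Qed.

Lemma fk_coef_bounded k : (0 < k)%N -> l2bounded (fk_coef R k) 8.
Proof.
move=> k0; have b1 := mult_coef_bounded R (ltn0Sn 0).
have bk := l2boundedZ (-1) (mult_coef_bounded R k0).
rewrite (_ : fk_coef R k = mult_coef R 1 \+ (fun n => -1 * mult_coef R k n)); last first.
  by apply/funext => n; rewrite /= /fk_coef {2}/mult_coef dvd1n mulN1r.
by apply: l2bounded_le (l2boundedD b1 bk); rewrite nmN nm1; lra.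
Qed.

Lemma span_coef_bounded (c : nat -> cplx R) N :
  exists B, l2bounded (fun n => \sum_(2 <= k < N) c k * fk_coef R k n) B.
Proof.
elim: N => [|N [B IH]].
  exists 0; rewrite (_ : (fun n => _) = fun=> 0); first exact: l2bounded0.
  by apply/funext => n; rewrite big_geq.
have [N2|N2] := ltnP N 2.
  exists 0; rewrite (_ : (fun n => _) = fun=> 0); first exact: l2bounded0.
  by apply/funext => n; rewrite big_geq.
have := l2boundedD IH (l2boundedZ (c N) (fk_coef_bounded (ltnW N2))).
rewrite (_ : _ \+ _ = fun n => \sum_(2 <= k < N.+1) c k * fk_coef R k n).
  by move=> ?; eexists; eassumption.
by apply/funext => n /=; rewrite big_nat_recr.
Qed.

Lemma sums_toB (f g : cplx R -> cplx R) a b :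
  sums_to f a 1 -> sums_to g b 1 -> sums_to (f \- g) (a \- b) 1.
Proof.
move=> fa gb z z1; have := csumD (fa z z1) (csumZ (-1) (gb z z1)).
rewrite mulN1r (_ : _ \+ _ = fun n => (a \- b) n * z ^+ n)//.
by apply/funext => n /=; rewrite mulN1r mulrBl.
Qed.

Lemma norm2_lty_coef (f : cplx R -> cplx R) a B :
  sums_to f a 1 -> l2bounded a B -> (norm2 f < +oo)%E.
Proof.
move=> fa aB; have B0 := l2bounded_ge0 aB; have k0 := weight_const_gt0 R.
apply: (@le_lt_trans _ _ (Num.sqrt (weight_const R * B))%:E); last exact: ltry.
apply: (norm2_le fa); first exact: sqrtr_ge0.
have kB : 0 <= weight_const R * B by rewrite mulr_ge0// ltW.
by rewrite (sqr_sqrtr kB) mulrAC divff ?mul1r// gt_eqF.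
Qed.

Lemma bergman_coef (f : cplx R -> cplx R) : bergman f ->
  exists2 a, sums_to f a 1 & exists B, l2bounded a B.
Proof.
move=> [/disk_power_series[a fa] nf]; exists a => //.
have e0 : (0 <= energy f)%E.
  by apply: planar_integral_ge0; apply: weighted_ge0 => z _; exact: sqr_ge0.
have : (energy f < +oo)%E.
  rewrite ltey; apply/eqP => eoo; move: nf; rewrite /norm2.
  have -> : integral_dA1 (fun z => (complex.Re `|f z| ^+ 2)%R) = +oo%E by rewrite
    integral_dA1E.
  by rewrite poweRyr ?ltxx// invr_eq0 pnatr_eq0.
case E : (energy f) e0 => [v|//|//] _ _.
exact: (sums_to_bessel fa E).
Qed.

End fk_series.

Theorem theorem1p1 (R : realType) : dense_in_bergman (span_from2 (@fk R)).
Proof.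
split=> [_ [N [c ->]]|f /bergman_coef[a fa [B aB]] e e0].
  have gc := span_sums_to c N; have [B cB] := span_coef_bounded c N.
  split; first exact: sums_to_analytic gc.
  exact: norm2_lty_coef gc cB.
(* [norm2_le] gives a non-strict bound, so e / 2 is aimed at; its square divided by the weight
   constant is the corresponding squared coefficient distance. *)
have k0 := weight_const_gt0 R; have e2 : 0 < e / 2 by rewrite divr_gt0.
have d0 : 0 < (e / 2) ^+ 2 / weight_const R by rewrite divr_gt0// exprn_gt0.
have [b [N [c bE]] ab] := closure_coef_full aB d0.
exists (fun z => \sum_(2 <= k < N) c k * fk k z); first by exists N, c.
apply: (@le_lt_trans _ _ (e / 2)%:E); last by rewrite lte_fin; lra.
apply: (@norm2_le _ _ (a \- b)) => //; last exact: ltW.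
apply: (sums_toB fa); rewrite (_ : b = fun n => \sum_(2 <= k < N) c k * fk_coef R k n).
  exact: span_sums_to.
by apply/funext.
Qed.
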